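(* Let $(\mathbf Z_n,\mathbf A_{n\times n})$ be generated from the stochastic block model with parameters $(k,\pi,\rho_nS)$. If $\alpha<\min_a\pi_a$ and $n\rho_n\to\infty$ as $n\to\infty$, then both $\hat{\mathbf z}_n^{\mathrm{ML}}$ and $\hat{\mathbf z}_n^{\mathrm{ICL}}$ are weakly consistent. Moreover, $\alpha$ can be taken as decreasing with $n$, at a rate $\alpha\gg(n\rho_n)^{-1/2}$.
   Context: Stochastic block model (SBM) with parameters $(k,\pi,\rho_nS)$: $k\ge2$ fixed; $\pi$ a probability vector on $[k]=\{1,\dots,k\}$ with all $\pi_a>0$; $S$ a fixed symmetric $k\times k$ matrix with strictly positive entries and no two identical columns; $\rho_n>0$ with $\rho_n\to0$. The labels $\mathbf Z_n=(Z_1,\dots,Z_n)$ are i.i.d. with law $\pi$; given $\mathbf Z_n=\mathbf z_n$, the adjacency matrix $\mathbf A_{n\times n}$ is symmetric with zero diagonal and entries $A_{ij}$, $i<j$, independent Bernoulli$(\rho_nS_{z_iz_j})$. For $\mathbf e_n\in[k]^n$ and the observed matrix $a$: $n_a(\mathbf e_n)=\#\{i:e_i=a\}$; $n_{ab}=n_an_b$ for $a\ne b$, $n_{aa}=n_a(n_a-1)$; $o_{ab}(\mathbf e_n)=\sum_{i,j}\mathbf 1\{e_i=a,e_j=b\}a_{ij}$; $\tau(x)=x\log x+(1-x)\log(1-x)$. $Q_{\mathrm{ML}}(\mathbf e_n)=\frac1{2n^2}\sum_{a,b}n_{ab}\tau(o_{ab}/n_{ab})$. With $\tilde o_{aa}=o_{aa}/2,\tilde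 n_{aa}=n_{aa}/2$ and $\tilde o_{ab}=o_{ab},\tilde n_{ab}=n_{ab}$ for $a\ne b$, $Q_{\mathrm{ICL}}(\mathbf e_n)=\frac1{n^2}\sum_{a\le b}\log\frac{B(\tilde o_{ab}+1/2,\tilde n_{ab}-\tilde o_{ab}+1/2)}{B(1/2,1/2)}$ ($B$ the beta function). For $\alpha>0$ let $\mathcal F(n,\alpha)=\{\mathbf e_n\in[k]^n: n_a(\mathbf e_n)\ge\alpha n\ \forall a\}$; $\hat{\mathbf z}_n^{\mathrm{ML}}$ (resp. $\hat{\mathbf z}_n^{\mathrm{ICL}}$) is a maximizer of $Q_{\mathrm{ML}}$ (resp. $Q_{\mathrm{ICL}}$) over $\mathcal F(n,\alpha)$. Let $m(\hat{\mathbf z}_n,\mathbf Z_n)=\min_\sigma\sum_{i=1}^n\mathbf 1\{\hat z_i\ne\sigma(Z_i)\}$, the minimum over permutations $\sigma$ of $[k]$. An estimator is weakly consistent if for all $\epsilon>0$, $\mathbb P(m(\hat{\mathbf z}_n,\mathbf Z_n)<\epsilon n)\to1$. *)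

(* Defs.v *)
From HB Require Import structures.
From mathcomp Require Import all_boot all_order all_algebra all_fingroup.
From mathcomp Require Import all_classical all_reals all_analysis.
Set Implicit Arguments. Unset Strict Implicit. Unset Printing Implicit Defensive.
Import Order.TTheory GRing.Theory Num.Theory numFieldNormedType.Exports.
Local Open Scope classical_set_scope.
Local Open Scope ring_scope.

Section SBM.
Context {R : realType}.

(** Labels e_n in [k]^n, with [k] = 'I_k; observed matrices are n x n boolean
    matrices (the model gives zero weight to non-symmetric ones or ones with
    a nonzero diagonal). *)
Definition labels (n k : nat) := {ffun 'I_n -> 'I_k}.
Definition adjmat (n : nat) := 'M[bool]_n.

Definition ncount {n k : nat} (e : labels n k) (a : 'I_k) : nat :=
  #|[set i | e i == a]|.

Definition npairs {n k : nat} (e : labels n k) (a b : 'I_k) : nat :=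
  if a == b then ncount e a * (ncount e a).-1 else ncount e a * ncount e b.

Definition oedges {n k : nat} (e : labels n k) (A : adjmat n) (a b : 'I_k) : nat :=
  \sum_(i < n) \sum_(j < n) ((e i == a) && (e j == b) && A i j).

Definition tau (x : R) : R := x * ln x + (1 - x) * ln (1 - x).

Definition Q_ML {n k : nat} (e : labels n k) (A : adjmat n) : R :=
  (2 * (n%:R ^+ 2))^-1 *
  \sum_(a < k) \sum_(b < k)
     ((npairs e a b)%:R * tau ((oedges e A a b)%:R / (npairs e a b)%:R)).

Definition betaR (x y : R) : R :=
  Rintegral lebesgue_measure `[0%R, 1%R]
    (fun t => powR t (x - 1) * powR (1 - t) (y - 1)).

Definition otilde {n k : nat} (e : labels n k) (A : adjmat n) (a b : 'I_k) : R :=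
  if a == b then (oedges e A a b)%:R / 2 else (oedges e A a b)%:R.
Definition ntilde {n k : nat} (e : labels n k) (a b : 'I_k) : R :=
  if a == b then (npairs e a b)%:R / 2 else (npairs e a b)%:R.

Definition Q_ICL {n k : nat} (e : labels n k) (A : adjmat n) : R :=
  (n%:R ^+ 2)^-1 *
  \sum_(a < k) \sum_(b < k | (a <= b)%N)
     ln (betaR (otilde e A a b + 2^-1) (ntilde e a b - otilde e A a b + 2^-1)
         / betaR (2^-1) (2^-1)).

Definition Fset (n k : nat) (alpha : R) : {set labels n k} :=
  [set e : labels n k | [forall a : 'I_k, alpha * n%:R <= (ncount e a)%:R]].

Definition mismatch {n k : nat} (zh z : labels n k) : nat :=
  \big[minn/n]_(s : {perm 'I_k}) #|[set i | zh i != s (z i)]|.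

(** Joint law of (Z_n, A) under SBM(k, pi, rho_n S): Z_i iid ~ pi; given Z,
    A symmetric with zero diagonal, A_ij (i<j) independent Bernoulli(rho_n S_{Z_i Z_j}). *)
Definition sbm_weight (k : nat) (pi : 'I_k -> R) (S : 'M[R]_k) (rhon : R)
    {n : nat} (z : labels n k) (A : adjmat n) : R :=
  (\prod_(i < n) pi (z i)) *
  \prod_(i < n) \prod_(j < n)
     (if (i < j)%N then
        (if A i j then rhon * S (z i) (z j) else 1 - rhon * S (z i) (z j))
      else if i == j then (~~ A i j)%:R
      else (A i j == A j i)%:R).

Definition sbm_prob (k : nat) (pi : 'I_k -> R) (S : 'M[R]_k) (rhon : R)
    (n : nat) (E : labels n k -> adjmat n -> bool) : R :=
  \sum_(z : labels n k) \sum_(A : adjmat n)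
     (E z A)%:R * sbm_weight pi S rhon z A.

Definition is_maximizer (k : nat) (alpha : nat -> R)
    (Q : forall n, labels n k -> adjmat n -> R)
    (est : forall n, adjmat n -> labels n k) : Prop :=
  forall n (A : adjmat n) (e : labels n k), e \in Fset n k (alpha n) ->
    est n A \in Fset n k (alpha n) /\ Q n e A <= Q n (est n A) A.

Definition weakly_consistent (k : nat) (pi : 'I_k -> R) (S : 'M[R]_k)
    (rho : nat -> R) (est : forall n, adjmat n -> labels n k) : Prop :=
  forall eps : R, 0 < eps ->
    (fun n => sbm_prob pi S (rho n)
        (fun z A => (mismatch (est n A) z)%:R < eps * n%:R)) @ \oo --> (1 : R).

Definition maximizers_weakly_consistent (k : nat) (pi : 'I_k -> R)
    (S : 'M[R]_k) (rho : nat -> R) (alpha : nat -> R)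
    (Q : forall n, labels n k -> adjmat n -> R) : Prop :=
  forall est : forall n, adjmat n -> labels n k,
    is_maximizer alpha Q est -> weakly_consistent pi S rho est.

End SBM.

(* Main.v *)
Require Import Defs.
From HB Require Import structures.
From mathcomp Require Import all_boot all_order all_algebra all_fingroup.
From mathcomp Require Import all_classical all_reals all_analysis.
From mathcomp Require Import ring lra.
From mathcomp Require Import measurable_realfun.
Import Order.TTheory GRing.Theory Num.Theory numFieldNormedType.Exports.
Local Open Scope classical_set_scope.
Local Open Scope ring_scope.

(* The ML criterion is, up to a term that does not depend on the labelling and
   up to errors of relative order [rho], the Poisson profile likelihood
   [sum_ab (o_ab ln (o_ab / n_ab) - o_ab)]. Let [M_ab] be the conditional mean of
   [o_ab / rho] given the true labels and [m_ab = M_ab / n_ab], which is an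
   average of entries of [S].

   Concentration. A Chernoff bound and a union bound over all [k ^ n] labellings
   give [|o_ab - rho M_ab| <= t n^2 rho] uniformly, with [t] of order
   [(n rho)^(-1/2)].

   Replacing [o_ab] by its mean. By convexity of [x ln x] the lower estimate loses
   [O(t)], as [ln m_ab] is bounded, and the upper one moreover loses
   [(o_ab - rho M_ab)^2 / (rho M_ab)], of relative order [(t / alpha)^2]: this is
   where [alpha >> (n rho)^(-1/2)] enters.

   Identification. A near-maximiser therefore satisfies
   [sum_(i != j) (S_(z_i z_j) - m_(e_i e_j))^2 = o(n^2)] by strong convexity, and
   since the columns of [S] are distinct, the estimated label determines the true
   one outside [o(n)] vertices.

   The ICL criterion differs from the ML one by [O(1/n)], because
   [ln (B(x + 1/2, N - x + 1/2) / B(1/2, 1/2)) = N tau(x / N) + O(ln (N + 1))]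
   once [N >= 1]. *)

(** * Scalar inequalities *)

Section RealInequalities.
Context {R : realType}.
Implicit Types x y m s N o th : R.

Lemma ln_le_subr1 x : 0 < x -> ln x <= x - 1.
Proof.
move=> x0; rewrite -[x in ln x](subrK 1) addrC.
by apply: le_ln1Dx; lra.
Qed.

(** Convexity of [x ln x]: the left side is its tangent line at [m]. *)
Lemma mul_ln_tangent x m : 0 <= x -> 0 < m -> x * ln m + x - m <= x * ln x.
Proof.
move=> x0 m0; move: x0; rewrite le_eqVlt => /orP[/eqP <-|x0]; first lra.
have mx0 : 0 < m / x by rewrite divr_gt0.
have := ln_le_subr1 _ mx0; rewrite ln_div ?posrE// => H.
have : x * (ln m - ln x) <= x * (m / x - 1) by rewrite ler_pM2l.
have -> : x * (m / x - 1) = m - x by field; rewrite gt_eqF.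
lra.
Qed.

(** The right side exceeds the tangent line at [m] by exactly the chi-square term
    [(x - m)^2 / m]. *)
Lemma mul_ln_le x m : 0 <= x -> 0 < m -> x * ln x <= x * ln m + x * (x / m - 1).
Proof.
move=> x0 m0; move: x0; rewrite le_eqVlt => /orP[/eqP <-|x0]; first lra.
have mx0 : 0 < x / m by rewrite divr_gt0.
have := ln_le_subr1 _ mx0; rewrite ln_div ?posrE// => H.
rewrite -mulrDr ler_pM2l//; lra.
Qed.

(* [ln u >= 2 (1 - 1 / sqrt u)] turns the Kullback-Leibler term into a squared
   Hellinger distance. *)
Lemma mul_ln_strongly_convex s m (s1 : R) : 0 < s -> 0 < m -> s <= s1 -> m <= s1 ->
  (s - m) ^+ 2 / (4 * s1) <= s * ln s - s * ln m - s + m.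
Proof.
move=> s0 m0 ss ms.
set a := Num.sqrt s; set b := Num.sqrt m.
have a0 : 0 < a by rewrite sqrtr_gt0.
have b0 : 0 < b by rewrite sqrtr_gt0.
have sE : s = a * a by rewrite -expr2 sqr_sqrtr// ltW.
have mE : m = b * b by rewrite -expr2 sqr_sqrtr// ltW.
have ba0 : 0 < b / a by rewrite divr_gt0.
have := ln_le_subr1 _ ba0; rewrite ln_div ?posrE// => H.
have lnsE : ln s = 2 * ln a by rewrite sE lnM ?posrE//; ring.
have lnmE : ln m = 2 * ln b by rewrite mE lnM ?posrE//; ring.
have H1 : s * (ln b - ln a) <= s * (b / a - 1) by rewrite ler_pM2l.
have H2 : s * (b / a - 1) = a * b - a * a by rewrite sE; field; rewrite gt_eqF.
apply: (@le_trans _ _ ((a - b) ^+ 2)); last by rewrite lnsE lnmE; nra.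
rewrite ler_pdivrMr; last lra.
(* The constant comes from [(a + b)^2 <= 2 (a^2 + b^2) = 2 (s + m) <= 4 s1]. *)
have -> : (s - m) ^+ 2 = (a - b) ^+ 2 * (a + b) ^+ 2 by rewrite sE mE; ring.
rewrite ler_wpM2l ?sqr_ge0//.
have := sqr_ge0 (a - b); nra.
Qed.

(** With [x = o / N], tangents are taken at [th] for [x ln x] and at [1] for [(1 - x) ln (1 - x)].
    The second contributes [- x], which turns the Bernoulli likelihood into its Poisson form. *)
Lemma mul_tau_ge o N th : 0 <= o -> o <= N -> 0 < N -> 0 < th ->
  o * ln th - N * th <= N * tau (o / N).
Proof.
move=> o0 oN N0 th0; rewrite /tau.
set x := o / N.
have x0 : 0 <= x by rewrite divr_ge0// ltW.
have x1 : x <= 1 by rewrite ler_pdivrMr// mul1r.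
have oE : o = N * x by rewrite mulrC divfK// gt_eqF.
have H1 := mul_ln_tangent _ _ x0 th0.
have x1' : 0 <= 1 - x by lra.
have H2 := mul_ln_tangent _ _ x1' (@ltr01 R).
rewrite ln1 mulr0 add0r in H2.
rewrite oE -mulrA -mulrBr ler_pM2l//; lra.
Qed.

(** Same two reference points. The first error is the chi-square term at [th], the second comes from
    [(1 - x) ln (1 - x) <= - x + x^2]. *)
Lemma mul_tau_le o N th : 0 <= o -> o <= N -> 0 < N -> 0 < th ->
  N * tau (o / N) <=
    o * ln th - N * th + (o - N * th) ^+ 2 / (N * th) + o ^+ 2 / N.
Proof.
move=> o0 oN N0 th0; rewrite /tau.
set x := o / N.
have x0 : 0 <= x by rewrite divr_ge0// ltW.
have x1 : x <= 1 by rewrite ler_pdivrMr// mul1r.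
have oE : o = N * x by rewrite mulrC divfK// gt_eqF.
have H1 := mul_ln_le _ _ x0 th0.
have x1' : 0 <= 1 - x by lra.
have H2 := mul_ln_le _ _ x1' (@ltr01 R).
rewrite ln1 mulr0 add0r divr1 in H2.
have -> : o * ln th - N * th + (o - N * th) ^+ 2 / (N * th) + o ^+ 2 / N =
  N * (x * ln th + x * (x / th - 1) + (1 - x) * (1 - x - 1)).
  by rewrite oE; field; rewrite !gt_eqF.
by rewrite ler_pM2l// lerD.
Qed.

(** [exp x = 1 / exp (- x) <= 1 / (1 - x)], and [(1 - x) (1 + x + 2 x^2) = 1 + x^2 (1 - 2 x)]. *)
Lemma expR_le_quadratic x : x <= 1 / 2 -> expR x <= 1 + x + 2 * x ^+ 2.
Proof.
move=> x2.
have H : 1 - x <= expR (- x) by have := expR_ge1Dx (- x).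
have H0 : 0 < 1 - x by lra.
have -> : expR x = (expR (- x))^-1 by rewrite expRN invrK.
apply: (@le_trans _ _ (1 - x)^-1).
  by rewrite lef_pV2 ?posrE// expR_gt0.
rewrite -[_^-1]mul1r ler_pdivrMr//.
have := sqr_ge0 x; nra.
Qed.

Lemma bernoulli_mgf_le (p x : R) : 0 <= p -> x <= 1 / 2 ->
  1 - p + p * expR x <= expR (p * x + 2 * p * x ^+ 2).
Proof.
move=> p0 x2.
apply: (@le_trans _ _ (1 + p * (expR x - 1))); first lra.
apply: (le_trans (expR_ge1Dx _)).
rewrite ler_expR.
have := expR_le_quadratic _ x2 => H.
have : p * (expR x - 1) <= p * (x + 2 * x ^+ 2) by rewrite ler_wpM2l//; lra.
lra.
Qed.

Lemma expRN_le x : 0 < x -> expR (- x) <= x^-1.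
Proof.
move=> x0; rewrite expRN lef_pV2 ?posrE ?expR_gt0//.
have := expR_ge1Dx x; lra.
Qed.

End RealInequalities.

(** * Block sums *)

(* [ncount] and [mismatch] take the cardinal of a classical set, so membership
   is [asbool] and does not compute. *)
Lemma card_classical_set (T : finType) (P : pred T) :
  #|[set i | P i]| = #|[pred i | P i]|.
Proof.
apply: eq_card => i; rewrite inE.
by apply/idP/idP => [/set_mem|Pi]; [|exact/mem_set].
Qed.

Section Blocks.
Context {R : realType} {n k : nat}.
Implicit Types (e z : labels n k) (w : 'I_n -> 'I_n -> R) (a b : 'I_k).

(** Common form of edge counts, pair counts and conditional means, so that each identity between
    block totals and pair totals is proved once. *)
Definition block_sum w e a b : R :=
  \sum_i \sum_j ((e i == a)%:R * (e j == b)%:R * w i j).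

(** Each ordered pair of vertices lies in exactly one block. *)
Lemma block_sum_mul w e (f : 'I_k -> 'I_k -> R) :
  \sum_a \sum_b block_sum w e a b * f a b =
  \sum_i \sum_j w i j * f (e i) (e j).
Proof.
rewrite pair_big/= [RHS]pair_big/=.
under eq_bigr do rewrite /block_sum pair_big/= mulr_suml.
rewrite exchange_big/=; apply: eq_bigr => -[i j] _ /=.
rewrite (bigD1 (e i, e j))//= !eqxx !mul1r big1 ?addr0// => -[a b] /=.
rewrite xpair_eqE negb_and ![_ == e _]eq_sym.
by case/orP => /negbTE ->; rewrite ?mul0r ?mulr0 ?mul0r.
Qed.

Lemma oedges_block_sum e (A : adjmat n) a b :
  (oedges e A a b)%:R = block_sum (fun i j => (A i j)%:R) e a b.
Proof.
rewrite /oedges /block_sum natr_sum; apply: eq_bigr => i _.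
rewrite natr_sum; apply: eq_bigr => j _.
by rewrite -!natrM !mulnb.
Qed.

Lemma ncount_sum e a : (ncount e a)%:R = \sum_i (e i == a)%:R :> R.
Proof.
rewrite /ncount card_classical_set -sum1_card natr_sum big_mkcond/=; apply: eq_bigr => i _.
by rewrite inE; case: (e i == a).
Qed.

Lemma npairs_block_sum e a b :
  (npairs e a b)%:R = block_sum (fun i j => (i != j)%:R) e a b.
Proof.
rewrite /npairs /block_sum; case: ifP => [/eqP<-|ab].
  rewrite natrM ncount_sum mulr_suml; apply: eq_bigr => i _.
  case: (eqVneq (e i) a) => [ia|_]; last first.
    by rewrite mul0r big1// => j _; rewrite !mul0r.
  (* A vertex in the class makes the truncated predecessor a genuine subtraction. *)
  have n0 : (0 < ncount e a)%N by rewrite /ncount card_classical_set; apply/card_gt0P; exists i; rewrite inE ia.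
  rewrite -subn1 natrB// ncount_sum mul1r.
  rewrite (bigD1 i)//= ia eqxx [RHS](bigD1 i)//= ia !eqxx mulr0 add0r.
  rewrite addrAC subrr add0r; apply: eq_bigr => j ji.
  by rewrite (eq_sym i j) ji mulr1 mul1r.
rewrite natrM !ncount_sum mulr_suml; apply: eq_bigr => i _.
rewrite mulr_sumr; apply: eq_bigr => j _.
case: (eqVneq i j) => [<-|_]; last by rewrite mulr1.
case: (eqVneq (e i) a) => [->|_]; last by rewrite !mul0r.
by rewrite ab !mulr0.
Qed.

Lemma npairs_le_sqr e a b : (npairs e a b)%:R <= n%:R ^+ 2 :> R.
Proof.
have H c : (ncount e c <= n)%N by rewrite -[X in (_ <= X)%N](card_ord n) max_card.
rewrite -natrX ler_nat -mulnn /npairs; case: ifP => _; apply: leq_mul => //.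
by apply: leq_trans (leq_pred _) _.
Qed.

Lemma npairs_ge e (q : R) : (forall a, q * n%:R <= (ncount e a)%:R) ->
  2 <= q * n%:R -> forall a b, (q * n%:R) ^+ 2 / 2 <= (npairs e a b)%:R.
Proof.
set Q := q * n%:R => Hq Q2 a b.
have := Hq a; have := Hq b; rewrite /npairs; case: ifP => _ hb ha.
  have c0 : (0 < ncount e a)%N by rewrite -(ltr_nat R); lra.
  (* A diagonal block loses one vertex, and [c (c - 1) >= c^2 / 2] for [c >= Q >= 2]. *)
  rewrite natrM -subn1 natrB//; nra.
rewrite natrM; nra.
Qed.

Lemma block_sum_le w1 w2 e a b : (forall i j, w1 i j <= w2 i j) ->
  block_sum w1 e a b <= block_sum w2 e a b.
Proof.
move=> H; apply: ler_sum => i _; apply: ler_sum => j _.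
by rewrite ler_wpM2l// mulr_ge0.
Qed.

Lemma block_sumZ c w e a b :
  block_sum (fun i j => c * w i j) e a b = c * block_sum w e a b.
Proof.
rewrite /block_sum mulr_sumr; apply: eq_bigr => i _.
by rewrite mulr_sumr; apply: eq_bigr => j _; rewrite mulrCA.
Qed.

Lemma oedges_le_npairs e (A : adjmat n) a b :
  (forall i, ~~ A i i) -> (oedges e A a b)%:R <= (npairs e a b)%:R :> R.
Proof.
move=> A0; rewrite oedges_block_sum npairs_block_sum.
apply: block_sum_le => i j; rewrite ler_nat.
by case: eqP => [->|_]; [rewrite (negbTE (A0 _)) | case: (A i j)].
Qed.

Definition mean_block (S : 'M[R]_k) z e a b : R :=
  block_sum (fun i j => (i != j)%:R * S (z i) (z j)) e a b.

Lemma mean_block_diag (S : 'M[R]_k) z a b :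
  mean_block S z z a b = S a b * (npairs z a b)%:R.
Proof.
rewrite npairs_block_sum -block_sumZ /mean_block /block_sum.
apply: eq_bigr => i _; apply: eq_bigr => j _.
case: (eqVneq (z i) a) => [->|_]; last by rewrite !mul0r.
by case: (eqVneq (z j) b) => [->|_]; [rewrite mulrC [S _ _ * _]mulrC mulrC|rewrite !(mulr0,mul0r)].
Qed.

Lemma mean_block_bounds (S : 'M[R]_k) z e (s0 s1 : R) a b :
  (forall a b, s0 <= S a b <= s1) ->
  s0 * (npairs e a b)%:R <= mean_block S z e a b <= s1 * (npairs e a b)%:R.
Proof.
move=> HS; rewrite npairs_block_sum -!block_sumZ.
by apply/andP; split; apply: block_sum_le => i j;
  have /andP[] := HS (z i) (z j); case: eqP => _ /=; lra.
Qed.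

End Blocks.

(** * Error bounds for a single block *)

Section Deterministic.
Context {R : realType}.

(** The reference point [th = rho M / N] makes [N th] equal to the mean [rho M]. The term [o ln rho]
    stays exact although [ln rho] is unbounded, because its sum over blocks is the same for every
    labelling. *)
Lemma tau_block_bounds (o N M rho T L s0 s1 N0 : R) :
  0 <= o <= N -> 0 < N0 <= N -> 0 < s0 -> s0 * N <= M <= s1 * N -> 0 < rho ->
  `|o - rho * M| <= T -> `|ln (M / N)| <= L ->
  o * ln rho + rho * (M * ln (M / N)) - rho * M - T * L <= N * tau (o / N)
  /\ N * tau (o / N) <= o * ln rho + rho * (M * ln (M / N)) - rho * M +
     (T * L + T ^+ 2 / (rho * s0 * N0) + 2 * rho ^+ 2 * s1 ^+ 2 * N
      + 2 * T ^+ 2 / N0).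
Proof.
move=> /andP[x0 oN] /andP[N00 N0N] s00 /andP[M0 M1] rho0 oT mL.
have N_gt0 : 0 < N by lra.
have M_gt0 : 0 < M by apply: lt_le_trans M0; rewrite mulr_gt0.
set m := M / N in mL *.
have m0 : 0 < m by rewrite divr_gt0.
have mE : N * (rho * m) = rho * M by rewrite /m; field; rewrite gt_eqF.
have th0 : 0 < rho * m by rewrite mulr_gt0.
have H1 := mul_tau_ge _ _ _ x0 oN N_gt0 th0.
have H2 := mul_tau_le _ _ _ x0 oN N_gt0 th0.
rewrite lnM ?posrE// mE mulrDr in H1 H2.
have T0 : 0 <= T by apply: le_trans oT.
(* Only the bounded factor [ln m] multiplies the fluctuation, which costs [T L]. *)
have om : `|o * ln m - rho * (M * ln m)| <= T * L.
  by rewrite mulrA -mulrBl normrM ler_pM.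
move: om; rewrite ler_norml => /andP[om1 om2].
have oT2 : (o - rho * M) ^+ 2 <= T ^+ 2 by rewrite -real_normK ?num_real// lerXn2r ?nnegrE.
split; first lra.
have E1 : (o - rho * M) ^+ 2 / (rho * M) <= T ^+ 2 / (rho * s0 * N0).
  have rM : rho * s0 * N0 <= rho * M.
    rewrite -mulrA ler_wpM2l ?(ltW rho0)//; apply: le_trans M0.
    by rewrite ler_wpM2l// ltW.
  rewrite ler_pM ?sqr_ge0 ?invr_ge0 ?mulr_ge0 ?(ltW rho0) ?(ltW M_gt0)//.
  by rewrite lef_pV2 ?posrE ?mulr_gt0//.
move: oT; rewrite ler_norml => /andP[oT1 oT'].
have E2 : o ^+ 2 / N <= 2 * rho ^+ 2 * s1 ^+ 2 * N + 2 * T ^+ 2 / N0.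
  have o1 : o <= rho * s1 * N + T.
    have : rho * M <= rho * (s1 * N) by rewrite ler_wpM2l// ltW.
    lra.
  (* [(u + v)^2 <= 2 u^2 + 2 v^2]. *)
  have o2 : o ^+ 2 <= 2 * (rho * s1 * N) ^+ 2 + 2 * T ^+ 2.
    have : o ^+ 2 <= (rho * s1 * N + T) ^+ 2.
      by rewrite lerXn2r ?nnegrE//; apply: le_trans o1.
    have := sqr_ge0 (rho * s1 * N - T); nra.
  apply: (@le_trans _ _ ((2 * (rho * s1 * N) ^+ 2 + 2 * T ^+ 2) / N)).
    by rewrite ler_wpM2r// invr_ge0 ltW.
  rewrite mulrDl lerD//.
    rewrite le_eqVlt; apply/orP; left; apply/eqP; field; rewrite gt_eqF//.
  rewrite ler_wpM2l ?mulr_ge0 ?sqr_ge0// lef_pV2 ?posrE//.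
lra.
Qed.
End Deterministic.

(** * The likelihood gap and identification *)

Section Gap.
Context {R : realType} {n k : nat}.
Implicit Types (e z : labels n k) (S : 'M[R]_k).

Definition tau_sum e (A : adjmat n) : R :=
  \sum_(a < k) \sum_(b < k)
     ((npairs e a b)%:R * tau ((oedges e A a b)%:R / (npairs e a b)%:R)).

Definition block_mean S z e a b : R := mean_block S z e a b / (npairs e a b)%:R.

Definition block_entropy S z e : R :=
  \sum_(a < k) \sum_(b < k) mean_block S z e a b * ln (block_mean S z e a b).

Definition total_mean S z : R := \sum_i \sum_j (i != j)%:R * S (z i) (z j).

Lemma block_mean_bounds S z e (s0 s1 : R) a b :
  (forall a b, s0 <= S a b <= s1) -> 0 < (npairs e a b)%:R :> R ->
  s0 <= block_mean S z e a b <= s1.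
Proof.
move=> HS N0; have /andP[h0 h1] := mean_block_bounds _ z e _ _ a b HS.
by rewrite /block_mean ler_pdivlMr// ler_pdivrMr// h0.
Qed.

Lemma abs_ln_le (s0 s1 m : R) : 0 < s0 -> s0 <= m <= s1 ->
  `|ln m| <= `|ln s0| + `|ln s1|.
Proof.
move=> s00 /andP[h0 h1].
have m0 : 0 < m by lra.
have l0 : ln s0 <= ln m by rewrite ler_ln ?posrE.
have l1 : ln m <= ln s1 by rewrite ler_ln ?posrE//; lra.
have := ler_norm (ln s1); have := ler_norm (- ln s0); rewrite normrN => a0 a1.
have := normr_ge0 (ln s1); have := normr_ge0 (ln s0) => b0 b1.
by rewrite ler_norml; apply/andP; split; lra.
Qed.

Lemma total_mean_blocks S z e :
  \sum_(a < k) \sum_(b < k) mean_block S z e a b = total_mean S z.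
Proof.
rewrite /total_mean; transitivity (\sum_(a < k) \sum_(b < k) mean_block S z e a b * 1).
  by apply: eq_bigr => a _; apply: eq_bigr => b _; rewrite mulr1.
rewrite (block_sum_mul _ e (fun _ _ => 1)).
by apply: eq_bigr => i _; apply: eq_bigr => j _; rewrite mulr1.
Qed.

(** In [main] only [block_entropy] depends on [e]: the edge total and [total_mean] are sums over all
    ordered pairs, however these are grouped. *)
Lemma tau_sum_bounds S z e (A : adjmat n) (rho T s0 s1 N0 : R) :
  let L := `|ln s0| + `|ln s1| in
  let O := \sum_i \sum_j (A i j)%:R in
  let main := O * ln rho + rho * block_entropy S z e - rho * total_mean S z in
  (forall i, ~~ A i i) -> 0 < s0 -> (forall a b, s0 <= S a b <= s1) ->
  0 < rho -> 0 < N0 -> (forall a b, N0 <= (npairs e a b)%:R) ->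
  (forall a b, `|(oedges e A a b)%:R - rho * mean_block S z e a b| <= T) ->
  main - k%:R ^+ 2 * (T * L) <= tau_sum e A /\
  tau_sum e A <= main + k%:R ^+ 2 * (T * L + T ^+ 2 / (rho * s0 * N0) +
      2 * rho ^+ 2 * s1 ^+ 2 * n%:R ^+ 2 + 2 * T ^+ 2 / N0).
Proof.
move=> L O main A0 s00 HS rho0 N00 HN HT.
have cst (c : R) : \sum_(a < k) \sum_(b < k) c = k%:R ^+ 2 * c.
  by rewrite !sumr_const !card_ord -mulrnA -[LHS]mulr_natl natrM expr2.
have OE : O * ln rho = \sum_(a < k) \sum_(b < k) (oedges e A a b)%:R * ln rho.
  under eq_bigr do under eq_bigr do rewrite oedges_block_sum.
  rewrite (block_sum_mul _ e (fun _ _ => ln rho)) /O mulr_suml.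
  by apply: eq_bigr => i _; rewrite mulr_suml.
have mainE : main = \sum_(a < k) \sum_(b < k)
   ((oedges e A a b)%:R * ln rho
     + rho * (mean_block S z e a b * ln (block_mean S z e a b))
     - rho * mean_block S z e a b).
  rewrite /main OE -(total_mean_blocks S z e) /block_entropy !mulr_sumr.
  rewrite -big_split/= -sumrB; apply: eq_bigr => a _.
  by rewrite !mulr_sumr -big_split/= -sumrB.
have Npos a b : 0 < (npairs e a b)%:R :> R by apply: lt_le_trans (HN a b).
have LL a b : `|ln (block_mean S z e a b)| <= L.
  exact/abs_ln_le/block_mean_bounds.
have oN a b : 0 <= ((oedges e A a b)%:R : R) <= (npairs e a b)%:R.
  by apply/andP; split; [exact: ler0n|exact: oedges_le_npairs].
have NN a b : 0 < N0 <= (npairs e a b)%:R by rewrite N00 HN.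
have B a b := tau_block_bounds _ _ _ rho T L s0 s1 N0 (oN a b) (NN a b) s00
  (mean_block_bounds _ z e _ _ a b HS) rho0 (HT a b) (LL a b).
split.
- rewrite -cst mainE -sumrB; apply: ler_sum => a _; rewrite -sumrB; apply: ler_sum => b _.
  by have [] := B a b.
- rewrite -cst mainE -big_split; apply: ler_sum => a _; rewrite -big_split; apply: ler_sum => b _ /=.
  have [_ /le_trans] := B a b; apply.
  rewrite lerD2l lerD2r lerD2l ler_wpM2l ?npairs_le_sqr//.
  by do 2 (apply: mulr_ge0; last exact: sqr_ge0).
Qed.

Definition gap_sum S z e : R :=
  \sum_i \sum_j (i != j)%:R * (S (z i) (z j) - block_mean S z e (e i) (e j)) ^+ 2.

(** Both entropies become sums over vertex pairs, and the difference is a sum of Kullback-Leibler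
    terms [s ln s - s ln m - s + m], each bounded below by strong convexity. *)
Lemma block_entropy_gap S z e (s0 s1 : R) :
  0 < s0 -> (forall a b, s0 <= S a b <= s1) ->
  (forall a b, 0 < (npairs e a b)%:R :> R) ->
  (forall a b, 0 < (npairs z a b)%:R :> R) ->
  gap_sum S z e / (4 * s1) <= block_entropy S z z - block_entropy S z e.
Proof.
move=> s00 HS He Hz.
have zzE : block_entropy S z z =
    \sum_i \sum_j (i != j)%:R * S (z i) (z j) * ln (S (z i) (z j)).
  rewrite /block_entropy (block_sum_mul _ z (fun a b => ln (block_mean S z z a b))).
  apply: eq_bigr => i _; apply: eq_bigr => j _.
  by rewrite /block_mean mean_block_diag mulfK// gt_eqF.
have zeE : block_entropy S z e =
    \sum_i \sum_j (i != j)%:R * S (z i) (z j) * ln (block_mean S z e (e i) (e j)).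
  exact: block_sum_mul.
have tot : total_mean S z = \sum_i \sum_j (i != j)%:R * block_mean S z e (e i) (e j).
  rewrite -(block_sum_mul (fun i j => (i != j)%:R) e) -(total_mean_blocks S z e).
  apply: eq_bigr => a _; apply: eq_bigr => b _.
  by rewrite -npairs_block_sum mulrC divfK// gt_eqF.
(* The linear part [- s + m] of each term is created by subtracting and adding [total_mean], the
   added copy being written with the block means of [e]. *)
have -> : block_entropy S z z - block_entropy S z e =
   block_entropy S z z - block_entropy S z e - total_mean S z + total_mean S z by ring.
rewrite {2}tot zzE zeE /total_mean -!sumrB -big_split/= /gap_sum mulr_suml.
apply: ler_sum => i _; rewrite -!sumrB -big_split/= mulr_suml.
apply: ler_sum => j _.
have /andP[S0 S1] := HS (z i) (z j).
have /andP[m0 m1] := block_mean_bounds _ z e _ _ _ _ HS (He (e i) (e j)).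
have := @mul_ln_strongly_convex _ (S (z i) (z j)) (block_mean S z e (e i) (e j)) s1.
move=> /(_ (lt_le_trans s00 S0) (lt_le_trans s00 m0) S1 m1).
by case: (i != j) => /=; lra.
Qed.

(** The lower bound at [z] and the upper bound at [e] share their label-free terms, which cancel;
    [E] is the slack by which [e] may fail to beat the truth. *)
Lemma gap_sum_le S z e (A : adjmat n) (rho T s0 s1 N0 E : R) :
  (forall i, ~~ A i i) -> 0 < s0 -> (forall a b, s0 <= S a b <= s1) ->
  0 < rho -> 0 < N0 ->
  (forall a b, N0 <= (npairs e a b)%:R) -> (forall a b, N0 <= (npairs z a b)%:R) ->
  (forall e' a b, `|(oedges e' A a b)%:R - rho * mean_block S z e' a b| <= T) ->
  tau_sum z A <= tau_sum e A + E ->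
  rho * (gap_sum S z e / (4 * s1)) <=
    k%:R ^+ 2 * (2 * (T * (`|ln s0| + `|ln s1|)) + T ^+ 2 / (rho * s0 * N0) +
      2 * rho ^+ 2 * s1 ^+ 2 * n%:R ^+ 2 + 2 * T ^+ 2 / N0) + E.
Proof.
move=> A0 s00 HS rho0 N00 HNe HNz HT HE.
have [_ U] := tau_sum_bounds S z e A rho T s0 s1 N0 A0 s00 HS rho0 N00 HNe (HT e).
have [L _] := tau_sum_bounds S z z A rho T s0 s1 N0 A0 s00 HS rho0 N00 HNz (HT z).
have G : rho * (gap_sum S z e / (4 * s1)) <=
    rho * (block_entropy S z z - block_entropy S z e).
  rewrite ler_wpM2l ?(ltW rho0)//; apply: (block_entropy_gap S z e s0 s1) => //.
    by move=> a b; exact: (lt_le_trans N00 (HNe a b)).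
  by move=> a b; exact: (lt_le_trans N00 (HNz a b)).
apply: (le_trans G); lra.
Qed.

End Gap.

(** * Identification of the labels *)

Section Identification.
Context {R : realType} {n k : nat}.
Implicit Types (e z : labels n k) (S : 'M[R]_k).

Lemma mismatch_le e z (s : {perm 'I_k}) (B : pred 'I_n) :
  (forall i, ~~ B i -> e i = s (z i)) -> (mismatch e z <= #|B|)%N.
Proof.
move=> HB; rewrite /mismatch -minEnat; apply: leq_trans (_ : (#|[pred i | e i != s (z i)]| <= _)%N).
  by rewrite -card_classical_set; exact: (@bigmin_le _ nat).
by apply: subset_leq_card; apply/fintype.subsetP => i; rewrite inE; apply: contraNT => /HB ->.
Qed.

(** Each true class has a representative outside [B]. Mapping the class to the estimated label of
    its representative is injective, since estimated labels determine true ones off [B], hence it is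
    the permutation sought. *)
Lemma mismatch_le_card e z (B : pred 'I_n) :
  (forall i i', ~~ B i -> ~~ B i' -> e i = e i' -> z i = z i') ->
  (forall c, (#|B| < ncount z c)%N) -> (mismatch e z <= #|B|)%N.
Proof.
move=> Heq Hbig.
have ex c : {i | ~~ B i & z i = c}.
  apply: cid2; have := Hbig c; rewrite /ncount card_classical_set ltnNge => H.
  have : ~~ ([pred i | z i == c] \subset B).
    by apply: contra H => /subset_leq_card.
  by move/subsetPn => [i]; rewrite inE => /eqP zi Bi; exists i.
pose s c := e (s2val (ex c)).
have s_inj : injective s.
  move=> c c' h; rewrite -(s2valP' (ex c)) -(s2valP' (ex c')).
  by apply: Heq h; [exact: (s2valP (ex c))|exact: (s2valP (ex c'))].
apply: (mismatch_le _ _ (perm s_inj)) => i Bi; rewrite permE /s.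
(* An injective self-map of a finite type is onto, so every estimated label is that of some
   representative. *)
have [j [zj]] : exists j, s j = e i by have [t st ts] := injF_bij s_inj; exists (t (e i)).
have jE : z i = j.
  rewrite -(s2valP' (ex j)); apply: Heq => //; exact: (s2valP (ex j)).
by rewrite jE.
Qed.

(* Two vertices with the same estimated label but different true labels cannot
   both have a small deviation [D i], because some class [d], of linear size,
   separates their true labels; hence off a small set the estimated label
   determines the true one. *)
Lemma mismatch_le_gap S z e (m : 'I_k -> 'I_k -> R) (Delta q eta : R) :
  0 < Delta -> 0 < q -> 4 <= q * n%:R -> 0 <= eta ->
  (forall c c', c != c' -> exists d, Delta <= (S c d - S c' d) ^+ 2) ->
  (forall c, q * n%:R <= (ncount z c)%:R) ->
  \sum_i \sum_j (i != j)%:R * (S (z i) (z j) - m (e i) (e j)) ^+ 2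
     <= eta * n%:R ^+ 2 ->
  8 * eta / (Delta * q) < q ->
  (mismatch e z)%:R <= 8 * eta / (Delta * q) * n%:R.
Proof.
move=> D0 q0 qn4 eta0 sep Hz Hsum Hq.
have n0 : 0 < n%:R :> R by rewrite -(pmulr_rgt0 _ q0); lra.
pose D i := \sum_j (i != j)%:R * (S (z i) (z j) - m (e i) (e j)) ^+ 2.
have Dge0 i : 0 <= D i by apply: sumr_ge0 => j _; rewrite mulr_ge0 ?sqr_ge0.
(* Chosen so that two deviations below [th] add up to less than [Delta / 2 * (q n / 2)], the lower
   bound obtained below for vertices that are confused. *)
pose th := Delta * q * n%:R / 8.
have th0 : 0 < th by rewrite divr_gt0// !mulr_gt0.
pose B := [pred i | th <= D i].
have cardB : #|B|%:R <= 8 * eta / (Delta * q) * n%:R.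
  (* Markov's inequality for the deviations [D i]. *)
  have : th * #|B|%:R <= eta * n%:R ^+ 2.
    apply: le_trans Hsum; rewrite -sum1_card natr_sum mulr_sumr big_mkcond.
    by apply: ler_sum => i _; rewrite -/(D i) inE mulr1; case: ifP => // _; exact: Dge0.
  move=> h; rewrite -(ler_pM2l th0); apply: (le_trans h).
  rewrite le_eqVlt; apply/orP; left; apply/eqP; rewrite /th; field.
  by rewrite !gt_eqF.
apply: (le_trans _ cardB); rewrite ler_nat; apply: mismatch_le_card; last first.
  move=> c; rewrite -(ltr_nat R); apply: le_lt_trans cardB _; apply: lt_le_trans (Hz c).
  by rewrite ltr_pM2r.
move=> i i'; rewrite !inE -!ltNge => Di Di' eii'; apply/eqP; apply: contraT => zz.
have [d Hd] := sep _ _ zz.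
have : Delta / 2 * (q * n%:R / 2) <= D i + D i'.
  rewrite -big_split/=.
  apply: (@le_trans _ _ (\sum_(j | (z j == d) && (j != i) && (j != i')) Delta / 2)).
    rewrite sumr_const -[X in _ <= X]mulr_natr ler_wpM2l//; first by rewrite divr_ge0// ltW.
    (* Discarding [i] and [i'] from class [d] leaves at least [q n - 2 >= q n / 2] vertices, as
       [q n >= 4]. *)
    have card2 : (ncount z d <= #|[pred j | (z j == d) && (j != i) && (j != i')]| + 2)%N.
      rewrite /ncount card_classical_set.
      pose P := [pred j | (z j == d) && (j != i) && (j != i')]; rewrite -/P.
      pose Q := [pred j | j \in [:: i; i']].
      apply: (@leq_trans #|[predU P & Q]|).
        apply: subset_leq_card; apply/fintype.subsetP => j; rewrite !inE => ->.
        by case: (j == i); case: (j == i').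
      have h := leq_addr #|[predI P & Q]| #|[predU P & Q]|.
      rewrite cardUI in h; apply: (leq_trans h); rewrite leq_add2l.
      exact: (card_size [:: i; i']).
    have := Hz d; rewrite -(ler_nat R) natrD in card2; lra.
  rewrite big_mkcond; apply: ler_sum => j _.
  have sq0 c : 0 <= (S c (z j) - m (e i') (e j)) ^+ 2 by exact: sqr_ge0.
  case: ifP => [/andP[/andP[/eqP zj ji] ji']|_]; last first.
    by rewrite addr_ge0// mulr_ge0// sqr_ge0.
  rewrite (eq_sym i) ji (eq_sym i') ji' !mul1r eii' zj.
  (* Parallelogram identity: [2 (x - m)^2 + 2 (y - m)^2 = (x - y)^2 + (x + y - 2 m)^2]. *)
  have := sqr_ge0 (S (z i) d + S (z i') d - 2 * m (e i') (e j)); nra.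
rewrite /th in Di Di'; lra.
Qed.

End Identification.

(** * Concentration *)

Section AdjacencyLaw.
Context {R : realType} {n : nat}.
Implicit Types (P : 'I_n -> 'I_n -> R) (A : adjmat n).

(** The conditional law of the graph in [sbm_weight], with free edge probabilities. *)
Definition adj_weight P A : R :=
  \prod_(i < n) \prod_(j < n)
     (if (i < j)%N then (if A i j then P i j else 1 - P i j)
      else if i == j then (~~ A i j)%:R
      else (A i j == A j i)%:R).

(* Replaces each entry below the diagonal by its discrepancy with the entry
   above, so that the symmetry constraint becomes a constraint on single
   entries and [adj_weight] a product of functions of single entries. *)
Definition twist A : adjmat n :=
  \matrix_(i, j) (if (j < i)%N then A i j (+) A j i else A i j).

Lemma twistK : involutive twist.
Proof.
move=> A; apply/matrixP => i j; rewrite !mxE.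
by case: (ltngtP j i) => //= _; rewrite addbK.
Qed.

Lemma adj_weight_twist P A : adj_weight P (twist A) =
  \prod_(i < n) \prod_(j < n)
     (if (i < j)%N then (if A i j then P i j else 1 - P i j) else (~~ A i j)%:R).
Proof.
apply: eq_bigr => i _; apply: eq_bigr => j _; rewrite !mxE.
case: (ltngtP i j) => [//|ji|/val_inj ->]; last by rewrite eqxx.
have -> : (i == j) = false by apply/eqP => ij; rewrite ij ltnn in ji.
by case: (A i j); case: (A j i).
Qed.

Lemma sum_matrix_prod (F : 'I_n -> 'I_n -> bool -> R) :
  \sum_(A : adjmat n) \prod_(i < n) \prod_(j < n) F i j (A i j) =
  \prod_(i < n) \prod_(j < n) (F i j true + F i j false).
Proof.
rewrite [RHS]pair_big/=.
under [RHS]eq_bigr do rewrite -(big_bool _ (F _ _)).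
rewrite bigA_distr_bigA/=.
rewrite (reindex (fun f : {ffun 'I_n * 'I_n -> bool} => (\matrix_(i, j) f (i, j) : adjmat n))).
  apply: eq_bigr => f _; rewrite pair_big/=.
  by apply: eq_bigr => -[i j] _; rewrite mxE.
exists (fun A : adjmat n => [ffun p => A p.1 p.2]) => [f _|A _].
  by apply/ffunP => -[i j]; rewrite ffunE mxE.
by apply/matrixP => i j; rewrite mxE ffunE.
Qed.

(** Independence of the entries above the diagonal. [twist] fixes these entries and makes the weight
    a product over single entries, so the sum over matrices factors. *)
Lemma adj_weight_expect P (g : 'I_n -> 'I_n -> bool -> R) :
  \sum_(A : adjmat n) (\prod_(i < n) \prod_(j < n | (i < j)%N) g i j (A i j)) *
     adj_weight P A =
  \prod_(i < n) \prod_(j < n | (i < j)%N)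
     (g i j true * P i j + g i j false * (1 - P i j)).
Proof.
rewrite (reindex_inj (can_inj twistK)).
pose F (i j : 'I_n) b := if (i < j)%N then g i j b * (if b then P i j else 1 - P i j)
                else (~~ b)%:R.
transitivity (\sum_(A : adjmat n) \prod_(i < n) \prod_(j < n) F i j (A i j)).
  apply: eq_bigr => A _; rewrite adj_weight_twist -big_split/=.
  apply: eq_bigr => i _; rewrite (big_mkcond (fun j : 'I_n => (i < j)%N)) -big_split/=.
  apply: eq_bigr => j _; rewrite /F /twist mxE; case: ifP => ij; last by rewrite mul1r.
  by rewrite ltnNge (ltnW ij).
rewrite sum_matrix_prod; apply: eq_bigr => i _; rewrite [RHS]big_mkcond/=.
by apply: eq_bigr => j _; rewrite /F; case: ifP => //= _; rewrite add0r.
Qed.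

Lemma adj_weight_total P : \sum_(A : adjmat n) adj_weight P A = 1.
Proof.
transitivity (\sum_(A : adjmat n) (\prod_(i < n) \prod_(j < n | (i < j)%N) 1) * adj_weight P A).
  by apply: eq_bigr => A _; rewrite big1 ?mul1r// => i _; rewrite big1.
rewrite (adj_weight_expect P (fun _ _ _ => 1)) big1// => i _; rewrite big1// => j _.
by rewrite !mul1r addrC subrK.
Qed.

Lemma adj_weight_ge0 P A : (forall i j, 0 <= P i j <= 1) -> 0 <= adj_weight P A.
Proof.
move=> HP; apply: prodr_ge0 => i _; apply: prodr_ge0 => j _.
have /andP[p0 p1] := HP i j.
by case: ifP => _; [case: ifP => _ //; rewrite subr_ge0|case: ifP].
Qed.

Lemma adj_weight_support P A : adj_weight P A != 0 ->
  (forall i, ~~ A i i) /\ (forall i j, A i j = A j i).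
Proof.
move=> /prodf_neq0 H.
have diag i : ~~ A i i.
  have /prodf_neq0 /(_ i isT) := H i isT.
  by rewrite ltnn eqxx; case: (A i i); rewrite ?eqxx.
have low (i j : 'I_n) : (j < i)%N -> A i j = A j i.
  move=> ji; have /prodf_neq0 /(_ j isT) := H i isT.
  rewrite ltnNge (ltnW ji)/=.
  have -> : (i == j) = false by apply/eqP => ij; rewrite ij ltnn in ji.
  by case: (A i j); case: (A j i); rewrite ?eqxx.
split=> // i j; case: (ltngtP i j) => [ij|/low//|/val_inj -> //].
by rewrite (low _ _ ij).
Qed.

End AdjacencyLaw.

(** * Exponential moments of the edge counts *)

Section BlockMgf.
Context {R : realType} {n k : nat}.
Implicit Types (e z : labels n k) (w : 'I_n -> 'I_n -> R) (A : adjmat n).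

(** Weight of the unordered pair [i], [j] in a symmetric block sum: both orders may count, so it
    reaches 2 on diagonal blocks. *)
Definition pair_coef e (a b : 'I_k) (i j : 'I_n) : R :=
  (e i == a)%:R * (e j == b)%:R + (e j == a)%:R * (e i == b)%:R.

Lemma pair_coef_bounds e a b i j : 0 <= pair_coef e a b i j <= 2.
Proof.
rewrite /pair_coef; case: (e i == a); case: (e j == b); case: (e j == a);
  case: (e i == b); rewrite /= ?(mul0r, mulr0, mulr1, addr0, add0r); lra.
Qed.

Lemma block_sum_upper w e a b : (forall i, w i i = 0) -> (forall i j, w i j = w j i) ->
  block_sum w e a b = \sum_(i < n) \sum_(j < n | (i < j)%N) pair_coef e a b i j * w i j.
Proof.
move=> w0 wC; pose h i j := (e i == a)%:R * (e j == b)%:R * w i j.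
transitivity (\sum_(i < n) \sum_(j < n | (i < j)%N) h i j +
  \sum_(i < n) \sum_(j < n | (j < i)%N) h i j).
  rewrite -big_split/=; apply: eq_bigr => i _.
  rewrite (bigID (fun j : 'I_n => (i < j)%N))/=; congr +%R.
  rewrite big_mkcond [RHS]big_mkcond/=; apply: eq_bigr => j _.
  case: (ltngtP i j) => // /val_inj ->.
  by rewrite w0 mulr0.
under [X in _ + X]eq_bigr do rewrite big_mkcond/=.
rewrite [X in _ + X]exchange_big/= -big_split/=; apply: eq_bigr => i _.
rewrite -big_mkcond/= -big_split/=; apply: eq_bigr => j _.
by rewrite /h (wC j i) -mulrDl.
Qed.

(** The pairs [i < j] are independent, so the moment factors. As [c <= 2], each factor is at most
    [exp (2 P (lam c)^2) <= exp (8 lam^2 rho s1)], and there are at most [n^2] pairs. *)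
Lemma block_mgf_le z e (a b : 'I_k) (S : 'M[R]_k) (rho lam s1 : R) :
  (forall a b, S a b = S b a) ->
  (forall a b, 0 <= rho * S a b <= 1) ->
  (forall a b, S a b <= s1) -> 0 < rho -> 0 <= s1 -> `|lam| <= 1 / 4 ->
  \sum_(A : adjmat n)
    expR (lam * ((oedges e A a b)%:R - rho * mean_block S z e a b)) *
      adj_weight (fun i j => rho * S (z i) (z j)) A
  <= expR (8 * lam ^+ 2 * rho * s1 * n%:R ^+ 2).
Proof.
move=> SC P0 S1 rho0 s10 lam4.
pose P (i j : 'I_n) := rho * S (z i) (z j).
pose c := pair_coef e a b.
have cb i j : 0 <= c i j <= 2 := pair_coef_bounds e a b i j.
pose g i j (x : bool) := expR (lam * (c i j * (x%:R - P i j))).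
have -> : \sum_(A : adjmat n)
    expR (lam * ((oedges e A a b)%:R - rho * mean_block S z e a b)) *
      adj_weight P A
  = \sum_(A : adjmat n) (\prod_(i < n) \prod_(j < n | (i < j)%N) g i j (A i j)) *
     adj_weight P A.
  apply: eq_bigr => A _.
  have [->|/adj_weight_support [A0 AC]] := eqVneq (adj_weight P A) 0.
    by rewrite !mulr0.
  congr (_ * _); rewrite oedges_block_sum /mean_block !block_sum_upper; first last.
  - by move=> i j; rewrite AC.
  - by move=> i; rewrite (negbTE (A0 i)).
  - by move=> i j; rewrite SC eq_sym.
  - by move=> i; rewrite eqxx mul0r.
  rewrite mulr_sumr -sumrB mulr_sumr expR_sum; apply: eq_bigr => i _.
  rewrite mulr_sumr -sumrB mulr_sumr expR_sum; apply: eq_bigr => j ij.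
  rewrite /g /P /c; congr expR.
  have -> : (i != j) = true by apply/eqP => ji; rewrite ji ltnn in ij.
  by rewrite mul1r; ring.
rewrite adj_weight_expect.
apply: (@le_trans _ _ (\prod_(i < n) \prod_(j < n | (i < j)%N)
   expR (8 * lam ^+ 2 * rho * s1))).
  have term i j : 0 <= g i j true * P i j + g i j false * (1 - P i j)
      <= expR (8 * lam ^+ 2 * rho * s1).
    have /andP[p0 p1] := P0 (z i) (z j); rewrite -/(P i j) in p0 p1.
    apply/andP; split.
      by apply: addr_ge0; apply: mulr_ge0 => //; rewrite ?expR_ge0 ?subr_ge0.
    have /andP[c0 c2] := cb i j.
    have -> : g i j true * P i j + g i j false * (1 - P i j) =
       expR (- (lam * c i j * P i j)) * (1 - P i j + P i j * expR (lam * c i j)).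
      rewrite /g /=.
      have -> : lam * (c i j * (1 - P i j)) = - (lam * c i j * P i j) + lam * c i j by ring.
      have -> : lam * (c i j * (0 - P i j)) = - (lam * c i j * P i j) by ring.
      rewrite expRD; ring.
    have lc : `|lam * c i j| <= 1 / 2.
      rewrite normrM (ger0_norm c0).
      have := normr_ge0 lam; nra.
    have lc2 : (lam * c i j) ^+ 2 <= 4 * lam ^+ 2.
      rewrite exprMn mulrC ler_wpM2r ?sqr_ge0//; nra.
    (* The linear term of this bound is cancelled by the centring factor. *)
    have := bernoulli_mgf_le (P i j) (lam * c i j) p0 (le_trans (ler_norm _) lc).
    move=> h; apply: (le_trans (ler_wpM2l (expR_ge0 _) h)).
    rewrite -expRD ler_expR.
    have : P i j <= rho * s1 by apply: ler_wpM2l; [exact: ltW|exact: S1].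
    have := sqr_ge0 (lam * c i j); nra.
  apply: ler_prod => i _; apply/andP; split.
    by apply: prodr_ge0 => j _; have /andP[] := term i j.
  by apply: ler_prod => j _; exact: term.
under eq_bigr do rewrite -expR_sum.
rewrite -expR_sum ler_expR.
apply: (@le_trans _ _ (\sum_(i < n) \sum_(j < n) 8 * lam ^+ 2 * rho * s1)).
  apply: ler_sum => i _; rewrite [leLHS]big_mkcond; apply: ler_sum => j _.
  case: ifP => // _; apply: mulr_ge0 => //; apply: mulr_ge0; last exact: ltW.
  by apply: mulr_ge0; [exact: ler0n|exact: sqr_ge0].
rewrite !sumr_const !card_ord -mulrnA -[leLHS]mulr_natl natrM expr2.
by rewrite mulrC.
Qed.

End BlockMgf.

Section Concentration.
Context {R : realType} {n k : nat}.
Variables (pi : 'I_k -> R) (S : 'M[R]_k) (rho : R).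
Hypothesis pi_gt0 : forall a, 0 < pi a.
Hypothesis pi_sum : \sum_(a < k) pi a = 1.
Hypothesis S_sym : forall a b, S a b = S b a.
Hypothesis rho_gt0 : 0 < rho.
Hypothesis P01 : forall a b, 0 <= rho * S a b <= 1.
Implicit Types (e z : labels n k) (A : adjmat n).

Let edge_prob z (i j : 'I_n) : R := rho * S (z i) (z j).

Lemma sum_labels_prod (h : 'I_n -> 'I_k -> R) :
  \sum_(z : labels n k) \prod_(i < n) h i (z i) = \prod_(i < n) \sum_c h i c.
Proof. by rewrite bigA_distr_bigA. Qed.

Lemma labels_total : \sum_(z : labels n k) \prod_(i < n) pi (z i) = 1.
Proof. by rewrite (sum_labels_prod (fun=> pi)) big1. Qed.

Lemma labels_weight_ge0 z : 0 <= \prod_(i < n) pi (z i).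
Proof. by apply: prodr_ge0 => i _; apply: ltW. Qed.

Lemma pi_le1 c : pi c <= 1.
Proof.
by rewrite -pi_sum (bigD1 c)//= lerDl sumr_ge0// => i _; apply: ltW.
Qed.

(** Chernoff's lower tail. With [lam = d / 4] and [pi c <= 1], one vertex contributes the exponent
    [- lam d + 2 (pi c) lam^2 <= - d^2 / 8]. *)
Lemma ncount_mgf_le (c : 'I_k) (al : R) : al <= pi c ->
  \sum_(z : labels n k)
     expR ((pi c - al) / 4 * (al * n%:R - (ncount z c)%:R)) * \prod_(i < n) pi (z i)
  <= expR (- (n%:R * ((pi c - al) ^+ 2 / 8))).
Proof.
move=> alc; set d := pi c - al; set lam := d / 4.
have d0 : 0 <= d by rewrite subr_ge0.
pose h (i : 'I_n) (c' : 'I_k) := expR (lam * (al - (c' == c)%:R)) * pi c'.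
have -> : \sum_(z : labels n k)
     expR (lam * (al * n%:R - (ncount z c)%:R)) * \prod_(i < n) pi (z i) =
   \sum_(z : labels n k) \prod_(i < n) h i (z i).
  apply: eq_bigr => z _; rewrite /h big_split/=; congr (_ * _).
  rewrite -expR_sum -mulr_sumr sumrB sumr_const card_ord mulr_natr.
  by rewrite ncount_sum.
rewrite sum_labels_prod.
have hb i : 0 <= \sum_c' h i c' <= expR (- (d ^+ 2 / 8)).
  apply/andP; split.
    by apply: sumr_ge0 => c' _; apply: mulr_ge0; [exact: expR_ge0|exact: ltW].
  rewrite (bigD1 c)//= {1}/h eqxx /=.
  have -> : \sum_(c' | c' != c) h i c' = expR (lam * al) * (1 - pi c).
    have -> : 1 - pi c = \sum_(c' | c' != c) pi c'.
      by rewrite -pi_sum (bigD1 c)//= addrAC subrr add0r.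
    rewrite mulr_sumr; apply: eq_bigr => c' /negbTE cc'.
    by rewrite /h cc' /= subr0.
  have -> : expR (lam * (al - 1)) = expR (lam * al) * expR (- lam).
    by rewrite -expRD; congr expR; ring.
  have -> : expR (lam * al) * expR (- lam) * pi c + expR (lam * al) * (1 - pi c) =
     expR (lam * al) * (1 - pi c + pi c * expR (- lam)) by ring.
  have l2 : - lam <= 1 / 2 by rewrite /lam; lra.
  have := bernoulli_mgf_le (pi c) (- lam) (ltW (pi_gt0 c)) l2.
  move=> H; apply: (le_trans (ler_wpM2l (expR_ge0 _) H)).
  rewrite -expRD ler_expR /lam.
  have dE : d = pi c - al by [].
  have := pi_le1 c; have := pi_gt0 c; have := sqr_ge0 d.
  have -> : al = pi c - d by rewrite dE; ring.
  nra.
apply: (@le_trans _ _ (\prod_(i < n) expR (- (d ^+ 2 / 8)))).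
  by apply: ler_prod => i _; exact: hb.
by rewrite prodr_const card_ord -expRM_natl mulrN.
Qed.

Lemma sbm_total :
  \sum_(z : labels n k) \sum_(A : adjmat n) sbm_weight pi S rho z A = 1.
Proof.
rewrite -[RHS]labels_total; apply: eq_bigr => z _.
by rewrite -mulr_sumr (adj_weight_total (edge_prob z)) mulr1.
Qed.

Lemma sbm_weight_ge0 z A : 0 <= sbm_weight pi S rho z A.
Proof.
apply: mulr_ge0; first exact: labels_weight_ge0.
by apply: (adj_weight_ge0 (edge_prob z)) => i j; exact: P01.
Qed.

Lemma sbm_prob_le1 E : sbm_prob pi S rho (n := n) E <= 1.
Proof.
rewrite -[leRHS]sbm_total; apply: ler_sum => z _; apply: ler_sum => A _.
by case: (E z A); rewrite ?mul1r// mul0r sbm_weight_ge0.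
Qed.

(** Markov's inequality and a union bound at once: the indicator of failure is dominated pointwise
    by a sum of exponentials, [f1] for small classes and [f2] for edge deviations of either sign. *)
Lemma sbm_prob_ge (E : labels n k -> adjmat n -> bool) (al T lam s1 : R) :
  (forall c, al < pi c) -> (forall a b, S a b <= s1) -> 0 <= s1 ->
  0 <= lam -> lam <= 1 / 4 ->
  (forall z A, (forall i, ~~ A i i) -> (forall i j, A i j = A j i) ->
    (forall c, al * n%:R <= (ncount z c)%:R) ->
    (forall e a b, `|(oedges e A a b)%:R - rho * mean_block S z e a b| <= T) ->
    E z A) ->
  1 - (\sum_(c < k) expR (- (n%:R * ((pi c - al) ^+ 2 / 8))) +
    (k ^ n)%:R * (k%:R ^+ 2 * (2 * expR (8 * lam ^+ 2 * rho * s1 * n%:R ^+ 2 - lam * T))))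
  <= sbm_prob pi S rho E.
Proof.
move=> alpi Ss1 s10 lam0 lam4 HE.
pose X z A e a b : R := (oedges e A a b)%:R - rho * mean_block S z e a b.
pose f1 z := \sum_(c < k) expR ((pi c - al) / 4 * (al * n%:R - (ncount z c)%:R)).
pose tail l z A e a b := expR (l * X z A e a b) * expR (- (lam * T)).
pose f2 z A := \sum_(e : labels n k) \sum_(a < k) \sum_(b < k)
   (tail lam z A e a b + tail (- lam) z A e a b).
have tail0 l z A e a b : 0 <= tail l z A e a b by rewrite mulr_ge0 ?expR_ge0.
have f1_ge0 z : 0 <= f1 z by apply: sumr_ge0 => c _; exact: expR_ge0.
have f2_ge0 z A : 0 <= f2 z A.
  by do 3 (apply: sumr_ge0 => ? _); apply: addr_ge0.
(* On failure, at positive weight, some class is too small or some block deviates by more than [T],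
   and the matching exponential is then at least 1. *)
have bad z A : (~~ E z A)%:R * sbm_weight pi S rho z A <=
    (f1 z + f2 z A) * sbm_weight pi S rho z A.
  have w0 := sbm_weight_ge0 z A.
  have [Ez|nE] := boolP (E z A).
    by rewrite mul0r mulr_ge0// addr_ge0.
  have [->|wn0] := eqVneq (sbm_weight pi S rho z A) 0; first by rewrite !mulr0.
  apply: ler_wpM2r => //=.
  have [A0 AC] : (forall i, ~~ A i i) /\ (forall i j, A i j = A j i).
    apply: (@adj_weight_support R n (edge_prob z)).
    by apply: contraNneq wn0 => h; rewrite /sbm_weight -/(adj_weight (edge_prob z) A) h mulr0.
  have [Hc|/existsNP[c /negP]] := pselect (forall c, al * n%:R <= (ncount z c)%:R); last first.
    rewrite -ltNge => hc.
    apply: (@le_trans _ _ (f1 z)); last by rewrite lerDl.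
    rewrite /f1 (bigD1 c)//=; apply: ler_wpDr; first by apply: sumr_ge0 => ? _; exact: expR_ge0.
    rewrite -[leLHS]expR0 ler_expR; apply: mulr_ge0; last by rewrite subr_ge0 ltW.
    by apply: divr_ge0 => //; rewrite subr_ge0 ltW.
  have [Ht|] := pselect (forall e a b, `|X z A e a b| <= T).
    by case/negP: nE; exact: HE.
  move=> /existsNP[e /existsNP[a /existsNP[b /negP]]]; rewrite -ltNge => hT.
  apply: (@le_trans _ _ (f2 z A)); last by rewrite lerDr.
  rewrite /f2 (bigD1 e)//= (bigD1 a)//= (bigD1 b)//=.
  rewrite -!addrA addrA; apply: ler_wpDr.
    apply: addr_ge0; first by apply: sumr_ge0 => ? _; apply: addr_ge0.
    apply: addr_ge0.
      by do 2 (apply: sumr_ge0 => ? _); apply: addr_ge0.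
    by do 3 (apply: sumr_ge0 => ? _); apply: addr_ge0.
  have [Xpos|Xneg] := leP 0 (X z A e a b).
    rewrite ger0_norm// in hT.
    apply: ler_wpDr; first exact: tail0.
    by rewrite /tail -expRD -[leLHS]expR0 ler_expR; nra.
  rewrite ltr0_norm// in hT.
  apply: ler_wpDl; first exact: tail0.
  by rewrite /tail -expRD -[leLHS]expR0 ler_expR; nra.
have compl : 1 - sbm_prob pi S rho E =
    \sum_(z : labels n k) \sum_(A : adjmat n) (~~ E z A)%:R * sbm_weight pi S rho z A.
  rewrite -{1}sbm_total /sbm_prob -sumrB; apply: eq_bigr => z _.
  rewrite -sumrB; apply: eq_bigr => A _.
  by case: (E z A); rewrite /= ?mul1r ?mul0r ?subrr ?subr0.
have f1_le : \sum_(z : labels n k) \sum_(A : adjmat n) f1 z * sbm_weight pi S rho z A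
    <= \sum_(c < k) expR (- (n%:R * ((pi c - al) ^+ 2 / 8))).
  under eq_bigr => z _.
    rewrite -mulr_sumr -mulr_sumr (adj_weight_total (edge_prob z)) mulr1 /f1 mulr_suml.
    over.
  rewrite exchange_big/=; apply: ler_sum => c _.
  by apply: ncount_mgf_le; exact: ltW.
set K := expR (8 * lam ^+ 2 * rho * s1 * n%:R ^+ 2 - lam * T).
have tail_le l z e a b : `|l| <= 1 / 4 -> l ^+ 2 = lam ^+ 2 ->
    \sum_(A : adjmat n) tail l z A e a b * adj_weight (edge_prob z) A <= K.
  move=> l4 l2.
  under eq_bigr do rewrite /tail mulrAC.
  rewrite -mulr_suml /K expRD; apply: ler_wpM2r; first exact: expR_ge0.
  rewrite -l2; apply: block_mgf_le => //.
(* The factors count the labellings, the blocks and the two signs. *)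
have f2_le z : \sum_(A : adjmat n) f2 z A * adj_weight (edge_prob z) A <=
    (k ^ n)%:R * (k%:R ^+ 2 * (2 * K)).
  have -> : \sum_(A : adjmat n) f2 z A * adj_weight (edge_prob z) A =
     \sum_(e : labels n k) \sum_(a < k) \sum_(b < k) \sum_(A : adjmat n)
       (tail lam z A e a b + tail (- lam) z A e a b) * adj_weight (edge_prob z) A.
    under eq_bigr do rewrite mulr_suml.
    rewrite exchange_big/=; apply: eq_bigr => e _.
    under eq_bigr do rewrite mulr_suml.
    rewrite exchange_big/=; apply: eq_bigr => a _.
    under eq_bigr do rewrite mulr_suml.
    by rewrite exchange_big.
  have -> : (k ^ n)%:R * (k%:R ^+ 2 * (2 * K)) =
      \sum_(e : labels n k) \sum_(a < k) \sum_(b < k) (2 * K).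
    rewrite !sumr_const !card_ord card_ffun !card_ord -!mulrnA -[RHS]mulr_natl !natrM.
    ring.
  do 3 (apply: ler_sum => ? _).
  under eq_bigr do rewrite mulrDl.
  rewrite big_split/= mulr_natl mulr2n lerD//; apply: tail_le.
  - by rewrite ger0_norm.
  - by [].
  - by rewrite normrN ger0_norm.
  - by rewrite sqrrN.
rewrite lerBlDr -lerBlDl compl.
apply: (@le_trans _ _ (\sum_(z : labels n k) \sum_(A : adjmat n)
    (f1 z + f2 z A) * sbm_weight pi S rho z A)).
  by apply: ler_sum => z _; apply: ler_sum => A _; exact: bad.
under eq_bigr do under eq_bigr do rewrite mulrDl.
under eq_bigr do rewrite big_split/=.
rewrite big_split/= lerD//.
have -> : (k ^ n)%:R * (k%:R ^+ 2 * (2 * K)) =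
    \sum_(z : labels n k) (\prod_(i < n) pi (z i)) * ((k ^ n)%:R * (k%:R ^+ 2 * (2 * K))).
  by rewrite -mulr_suml labels_total mul1r.
apply: ler_sum => z _.
under eq_bigr do rewrite /sbm_weight mulrCA.
by rewrite -mulr_sumr ler_wpM2l ?labels_weight_ge0.
Qed.

End Concentration.

(** * Beta integrals and the ICL criterion *)

Section BetaIntegral.
Context {R : realType}.
Notation mu := (@lebesgue_measure R).

Definition beta_integrand (x y t : R) : R := powR t (x - 1) * powR (1 - t) (y - 1).

Lemma beta_integrand_ge0 x y t : 0 <= beta_integrand x y t.
Proof. by rewrite mulr_ge0 ?powR_ge0. Qed.

Lemma beta_integrandE x y t : 0 < t < 1 ->
  beta_integrand x y t = expR ((x - 1) * ln t + (y - 1) * ln (1 - t)).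
Proof.
move=> /andP[t0 t1]; rewrite /beta_integrand /powR !gt_eqF ?subr_gt0//.
by rewrite -expRD.
Qed.

Lemma measurable_beta_integrand x y (D : set R) : measurable D ->
  measurable_fun D (EFin \o beta_integrand x y).
Proof.
move=> mD; apply/measurable_EFinP; apply: measurable_funTS.
apply: measurable_funM; first exact: measurable_powR.
apply: (measurableT_comp (measurable_powR _)).
exact: measurable_funB.
Qed.

(** Dropping the endpoints, a null set, keeps [t] and [1 - t] positive, so that the powers are
    exponentials of logarithms. *)
Lemma betaR_open x y : betaR x y =
  fine (\int[mu]_(t in `]0%R, 1%R[) (beta_integrand x y t)%:E)%E.
Proof.
rewrite /betaR /Rintegral; congr fine.
by apply: integral_itv_bndoo; apply: measurable_beta_integrand.
Qed.

Let half : R := 2^-1.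

(** One of [t], [1 - t] is at least [1/2] and its power is at most 2. This separates the two
    singularities and leaves a function with an explicit primitive. *)
Lemma arcsine_density_le (t : R) : 0 < t < 1 ->
  beta_integrand half half t <=
  2 * (powR t (half - 1) + powR (1 - t) (half - 1)).
Proof.
move=> /andP[t0 t1].
have key (u : R) : 1 / 2 <= u -> powR u (half - 1) <= 2.
  move=> u2; have u0 : 0 < u by lra.
  have -> : half - 1 = - half by rewrite /half; lra.
  rewrite powRN powR12_sqrt ?(ltW u0)// -[leRHS]invrK.
  rewrite lef_pV2 ?posrE ?sqrtr_gt0//.
  have -> : 2^-1 = Num.sqrt (2^-1 ^+ 2) :> R by rewrite sqrtr_sqr ger0_norm.
  rewrite ler_sqrt//; lra.
have a0 := powR_ge0 t (half - 1); have b0 := powR_ge0 (1 - t) (half - 1).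
rewrite /beta_integrand; have [t2|t2] := leP (1 / 2) t.
  have := key t t2; nra.
have h : 1 / 2 <= 1 - t by lra.
have := key _ h; nra.
Qed.

Let primitive (t : R) : R := 4 * powR t half - 4 * powR (1 - t) half.

Lemma is_derive_primitive (t : R) : 0 < t < 1 ->
  is_derive t 1 primitive (2 * (powR t (half - 1) + powR (1 - t) (half - 1))).
Proof.
move=> /andP[t0 t1].
have d1 : is_derive t 1 (fun t : R => powR t half) (half * powR t (half - 1)).
  exact: is_derive1_powR.
have d2 : is_derive t 1 (fun t : R => powR (1 - t) half)
    (half * powR (1 - t) (half - 1) * (0 - 1)).
  apply: (@is_derive1_comp R (fun u => powR u half) (fun t => 1 - t)).
  by apply: is_derive1_powR; rewrite subr_gt0.
have := is_deriveB (is_deriveZ 4 d1) (is_deriveZ 4 d2).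
move=> d; apply: is_derive_eq d _.
by rewrite /GRing.scale/= /half; lra.
Qed.

Lemma integral_arcsine_trunc (n : nat) :
  (\int[mu]_(t in `[(n.+3%:R)^-1%R, (1 - (n.+3%:R)^-1)%R])
     (2 * (powR t (half - 1) + powR (1 - t) (half - 1)))%:E <= 8%:E)%E.
Proof.
(* Starting at [1/3] keeps the interval nondegenerate. On it both powers in [primitive] lie between
   0 and 1, whence the bound 8. *)
set d := (n.+3%:R)^-1 : R.
have d0 : 0 < d by rewrite invr_gt0.
have d3 : d <= 3^-1 by rewrite lef_pV2 ?posrE// ler_nat.
have dd : d < 1 - d by lra.
have der (x : R) : x \in `[d, 1 - d] ->
    is_derive x 1 primitive (2 * (powR x (half - 1) + powR (1 - x) (half - 1))).
  rewrite in_itv/= => /andP[x0 x1]; apply: is_derive_primitive.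
  by apply/andP; split; lra.
have cont : {within `[d, 1 - d], continuous primitive}.
  by apply: derivable_within_continuous => x /der h; apply: ex_derive.
have /(continuous_within_itvP _ dd) [_ cl cr] := cont.
rewrite (continuous_FTC2 dd (F := primitive)).
- rewrite -EFinB lee_fin /primitive.
  have b (u : R) : 0 <= u <= 1 -> 0 <= powR u half <= 1.
    move=> /andP[u0 u1]; rewrite powR_ge0/=.
    rewrite powR12_sqrt//; rewrite -[leRHS]sqrtr1 ler_sqrt//.
  have := b d; have := b (1 - d); have := b (1 - (1 - d)).
  move=> /(_ ltac:(apply/andP; split; lra)) /andP[_ b1].
  move=> /(_ ltac:(apply/andP; split; lra)) /andP[b2 b3].
  move=> /(_ ltac:(apply/andP; split; lra)) /andP[b4 b5].
  have b6 := powR_ge0 (1 - (1 - d)) half; lra.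
- apply: derivable_within_continuous => x; rewrite in_itv/= => /andP[x0 x1].
  apply: derivableM => //; apply: derivableD.
    by apply: derivable_powR; rewrite in_itv/= andbT; lra.
  have x1' : 0 < 1 - x by lra.
  apply: ex_derive; apply: (@is_derive1_comp R (fun u => powR u (half - 1)) (fun t => 1 - t)).
  exact: is_derive1_powR.
- split; [by move=> x /subset_itv_oo_cc /der h; exact: ex_derive|exact: cl|exact: cr].
- by move=> x /subset_itv_oo_cc /der h; rewrite derive1E; exact: derive_val.
Qed.

(** Monotone convergence along compact intervals exhausting the open one. Finiteness matters because
    [fine] sends an infinite integral to 0. *)
Lemma integral_arcsine_lty :
  (\int[mu]_(t in `]0%R, 1%R[) (beta_integrand half half t)%:E < +oo)%E.
Proof.
pose F (n : nat) : set R := `[(n.+3%:R)^-1, 1 - (n.+3%:R)^-1]%classic.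
have mF n : measurable (F n) by exact: measurable_itv.
have mf n : measurable_fun (F n) (EFin \o beta_integrand half half).
  exact: measurable_beta_integrand.
have FE : \bigcup_n F n = `]0%R, 1%R[%classic.
  apply/seteqP; split=> [t [n _]|t]; rewrite /F /= !in_itv/= => /andP[t0 t1].
    have d0 : 0 < (n.+3%:R)^-1 :> R by rewrite invr_gt0.
    by rewrite (lt_le_trans d0 t0)/= (le_lt_trans t1)// ltrBlDr ltrDl.
  have m0 : 0 < Num.min t (1 - t) by rewrite lt_min t0 subr_gt0.
  have [n _ hn] := near_infty_natSinv_lt (PosNum m0).
  have h := hn n (leqnn n).
  exists n => //=; rewrite in_itv/=.
  have h3 : (n.+3%:R)^-1 <= (n.+1%:R)^-1 :> R.
    by rewrite lef_pV2 ?posrE ?ltr0n// ler_nat (leq_addl 2 n.+1).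
  move: h => /=; rewrite lt_min => /andP[h1 h2].
  rewrite (le_trans h3 (ltW h1))/= lerBrDr -lerBrDl.
  exact: le_trans h3 (ltW h2).
have ndF : nondecreasing_seq F.
  apply/nondecreasing_seqP => n; apply/subsetPset => t; rewrite /F /= !in_itv/=.
  have h : (n.+4%:R)^-1 <= (n.+3%:R)^-1 :> R.
    by rewrite lef_pV2 ?posrE ?ltr0n// ler_nat leqnSn.
  move=> /andP[t0 t1]; rewrite (le_trans h t0)/=.
  by apply: (le_trans t1); rewrite lerB.
have f0 n t : F n t -> (0 <= (beta_integrand half half t)%:E)%E.
  by move=> _; rewrite lee_fin beta_integrand_ge0.
have cvgF : (\int[mu]_(t in F i) (beta_integrand half half t)%:E)%E @[i --> \oo] -->
    (\int[mu]_(t in \bigcup_i F i) (beta_integrand half half t)%:E)%E.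
  exact: ge0_nondecreasing_set_cvg_integral.
rewrite FE in cvgF; rewrite -(cvg_lim _ cvgF)//.
apply: (@le_lt_trans _ _ 8%:E); last by rewrite ltry.
apply: lime_le.
  exact: cvgP cvgF.
near=> n.
apply: le_trans (integral_arcsine_trunc n).
apply: ge0_le_integral => //.
- exact: measurable_itv.
- exact: f0.
- by apply: measurable_beta_integrand; exact: measurable_itv.
- apply/measurable_EFinP; apply: measurable_funTS.
  apply: measurable_funM => //; apply: measurable_funD; first exact: measurable_powR.
  apply: (measurableT_comp (measurable_powR _)).
  exact: measurable_funB.
- move=> t; rewrite /F/= in_itv/= => /andP[t0 t1].
  rewrite lee_fin; apply: arcsine_density_le.
  have d0 : 0 < (n.+3%:R)^-1 :> R by rewrite invr_gt0.
  by rewrite (lt_le_trans d0 t0)/= (le_lt_trans t1)// ltrBlDr ltrDl.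
Unshelve. all: by end_near. Qed.

Lemma beta_integral_ge (x y c u v : R) : 0 <= c -> 0 <= u -> u < v -> v <= 1 ->
  (forall t, u < t < v -> c <= beta_integrand x y t) ->
  ((c * (v - u))%:E <= \int[mu]_(t in `]0%R, 1%R[) (beta_integrand x y t)%:E)%E.
Proof.
move=> c0 u0 uv v1 h.
have -> : (c * (v - u))%:E = (\int[mu]_(t in `]u, v[) (cst c%:E t))%E.
  by rewrite integral_cst//= lebesgue_measure_itv/= lte_fin uv EFinM EFinB.
apply: (@le_trans _ _ (\int[mu]_(t in `]u, v[) (beta_integrand x y t)%:E)%E).
  apply: ge0_le_integral => //.
  exact: measurable_beta_integrand.
apply: ge0_subset_integral => //.
- exact: measurable_beta_integrand.
- by move=> t _; rewrite lee_fin beta_integrand_ge0.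
- move=> t /=; rewrite !in_itv/= => /andP[a b]; apply/andP; split; lra.
Qed.

Lemma beta_integral_le (x y c : R) : 0 <= c ->
  (forall t, 0 < t < 1 -> beta_integrand x y t <= c * beta_integrand half half t) ->
  (\int[mu]_(t in `]0%R, 1%R[) (beta_integrand x y t)%:E <=
   c%:E * \int[mu]_(t in `]0%R, 1%R[) (beta_integrand half half t)%:E)%E.
Proof.
move=> c0 h; rewrite -ge0_integralZl_EFin//; first last.
- exact: measurable_beta_integrand.
- by move=> t _; rewrite lee_fin beta_integrand_ge0.
apply: ge0_le_integral => //.
- by move=> t _; rewrite lee_fin beta_integrand_ge0.
- exact: measurable_beta_integrand.
- by apply: measurable_funeM; exact: measurable_beta_integrand.
Qed.

Lemma betaR_half_gt0 : 0 < betaR (2^-1) (2^-1) :> R.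
Proof.
rewrite betaR_open; apply: fine_gt0; rewrite integral_arcsine_lty andbT.
apply: (@lt_le_trans _ _ (1 * (1 - 0))%:E).
  by rewrite lte_fin; lra.
apply: beta_integral_ge => // t t01.
rewrite beta_integrandE// -[leLHS]expR0 ler_expR.
move: t01 => /andP[t0 t1].
have l1 : ln t <= 0 by apply: le_trans (ln_le_subr1 _ t0) _; lra.
have t1' : 0 < 1 - t by lra.
have l2 : ln (1 - t) <= 0 by apply: le_trans (ln_le_subr1 _ t1') _; lra.
nra.
Qed.

(** Gibbs' inequality: the binomial log-likelihood is largest at [t = x / N]. *)
Lemma cross_entropy_le (x N t : R) : 0 <= x -> x <= N -> 0 < N -> 0 < t < 1 ->
  x * ln t + (N - x) * ln (1 - t) <= N * tau (x / N).
Proof.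
move=> x0 xN N0 /andP[t0 t1].
have t1' : 0 < 1 - t by lra.
set p := x / N.
have xE : x = N * p by rewrite /p mulrC divfK// gt_eqF.
have p0 : 0 <= p by rewrite divr_ge0// ltW.
have p1 : 0 <= 1 - p by rewrite subr_ge0 ler_pdivrMr// mul1r.
have h1 := mul_ln_tangent _ _ p0 t0.
have h2 := mul_ln_tangent _ _ p1 t1'.
have -> : x * ln t + (N - x) * ln (1 - t) = N * (p * ln t + (1 - p) * ln (1 - t)).
  by rewrite xE; ring.
by rewrite ler_pM2l// /tau; lra.
Qed.

Lemma ln_ratio_bounds (B B0 a N : R) : 0 < B0 -> 0 < N ->
  expR (a - 1) * (N + 1)^-1 <= B -> B <= expR a * B0 ->
  a - ln (N + 1) - 1 - ln B0 <= ln (B / B0) /\ ln (B / B0) <= a.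
Proof.
move=> B0_gt0 N0 IL IU.
have d0 : 0 < (N + 1)^-1 by rewrite invr_gt0; lra.
have c_gt0 : 0 < expR (a - 1) * (N + 1)^-1 by rewrite mulr_gt0 ?expR_gt0.
have B_gt0 : 0 < B by apply: lt_le_trans IL.
have h1 : ln (expR (a - 1) * (N + 1)^-1) <= ln B by rewrite ler_ln ?posrE.
have h2 : ln B <= ln (expR a * B0) by rewrite ler_ln ?posrE ?mulr_gt0 ?expR_gt0.
have N1 : 0 < N + 1 by lra.
rewrite lnM ?posrE ?expR_gt0// expRK lnV ?posrE// in h1.
rewrite lnM ?posrE ?expR_gt0// expRK in h2.
by rewrite ln_div ?posrE//; split; lra.
Qed.

Lemma ln_beta_bounds (x N : R) : 0 <= x -> x <= N -> 0 < N ->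
  let B := betaR (x + 2^-1) (N - x + 2^-1) in let B0 := betaR (2^-1) (2^-1) in
  N * tau (x / N) - ln (N + 1) - 1 - ln B0 <= ln (B / B0) /\
  ln (B / B0) <= N * tau (x / N).
Proof.
move=> x0 xN N0 B B0.
have B0_gt0 : 0 < B0 := betaR_half_gt0.
set I0 := (\int[mu]_(t in `]0%R, 1%R[) (beta_integrand half half t)%:E)%E.
have I0E : I0 = B0%:E.
  rewrite /B0 betaR_open fineK// ge0_fin_numE ?integral_arcsine_lty//.
  by apply: integral_ge0 => t _; rewrite lee_fin beta_integrand_ge0.
set I := (\int[mu]_(t in `]0%R, 1%R[)
  (beta_integrand (x + half) (N - x + half) t)%:E)%E.
have IU : (I <= (expR (N * tau (x / N)) * B0)%:E)%E.
  rewrite EFinM -I0E; apply: beta_integral_le; first exact: expR_ge0.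
  move=> t t01; rewrite !beta_integrandE// -expRD ler_expR.
  have := cross_entropy_le x N t x0 xN N0 t01; lra.
have IE : I = B%:E.
  rewrite /B betaR_open fineK// ge0_fin_numE.
    by apply: le_lt_trans IU _; rewrite ltry.
  by apply: integral_ge0 => t _; rewrite lee_fin beta_integrand_ge0.
rewrite IE lee_fin in IU.
(* On an interval of length [d = 1/(N+1)] around [p = x/N], the integrand loses
   at most the factor [(1 - d) ^ N >= 1/e]. *)
set p := x / N; set d := (N + 1)^-1.
have xE : x = N * p by rewrite /p mulrC divfK// gt_eqF.
have p0 : 0 <= p by rewrite divr_ge0// ltW.
have p1 : p <= 1 by rewrite ler_pdivrMr// mul1r.
have N1 : 0 < N + 1 by lra.
have d0 : 0 < d by rewrite invr_gt0.
have d1 : d < 1 by rewrite invf_lt1//; lra.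
have lnd : - N^-1 <= ln (1 - d).
  have -> : 1 - d = ((N + 1) / N)^-1 by rewrite /d; field; rewrite !gt_eqF.
  have q0 : 0 < (N + 1) / N by rewrite divr_gt0.
  rewrite lnV ?posrE// lerN2; apply: (le_trans (ln_le_subr1 _ q0)).
  by rewrite le_eqVlt; apply/orP; left; apply/eqP; field; rewrite gt_eqF.
have IL : expR (N * tau p - 1) * d <= B.
  rewrite -lee_fin -IE.
  (* The window from [(1 - d) p] to [(1 - d) p + d] stays in the unit interval, and on it [t]
     exceeds [(1 - d) p] and [1 - t] exceeds [(1 - d) (1 - p)]. *)
  have -> : d = ((1 - d) * p + d) - (1 - d) * p by ring.
  apply: beta_integral_ge.
  - exact: expR_ge0.
  - by rewrite mulr_ge0// subr_ge0 ltW.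
  - by rewrite ltrDl.
  - nra.
  move=> t /andP[tl tr].
  have t0 : 0 < t by apply: le_lt_trans tl; rewrite mulr_ge0// subr_ge0 ltW.
  have tr' : (1 - d) * (1 - p) < 1 - t by lra.
  have t1' : 0 < 1 - t by apply: le_lt_trans tr'; rewrite mulr_ge0// subr_ge0// ltW.
  have t01 : 0 < t < 1 by apply/andP; split; lra.
  rewrite beta_integrandE// ler_expR.
  have l1 : ln t <= 0 by apply: le_trans (ln_le_subr1 _ t0) _; lra.
  have l2 : ln (1 - t) <= 0 by apply: le_trans (ln_le_subr1 _ t1') _; lra.
  have part (q s : R) : 0 <= q -> (1 - d) * q < s -> q * (ln (1 - d) + ln q) <= q * ln s.
    rewrite le_eqVlt => /orP[/eqP <-|q0] qs; first by rewrite !mul0r.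
    have d1' : 0 < 1 - d by lra.
    rewrite ler_pM2l// -lnM ?posrE// ler_ln ?posrE ?ltW//.
      exact: mulr_gt0.
    by apply: lt_trans qs; exact: mulr_gt0.
  have q0 : 0 <= 1 - p by lra.
  have h1 := part _ _ p0 tl; have h2 := part _ _ q0 tr'.
  have h3 : N * (tau p + ln (1 - d)) <= N * (p * ln t + (1 - p) * ln (1 - t)).
    by rewrite ler_pM2l// /tau; lra.
  have h4 : -1 <= N * ln (1 - d).
    have := ler_wpM2l (ltW N0) lnd; rewrite mulrN mulfV ?gt_eqF//.
  have -> : (x + half - 1) * ln t + (N - x + half - 1) * ln (1 - t) =
    N * (p * ln t + (1 - p) * ln (1 - t)) + (half - 1) * (ln t + ln (1 - t)).
    by rewrite xE; ring.
  have : 0 <= (half - 1) * (ln t + ln (1 - t)) by rewrite /half; nra.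
  lra.
exact: ln_ratio_bounds.
Qed.

End BetaIntegral.

(** * Comparison of the two criteria *)

Section IclVersusMl.
Context {R : realType} {n k : nat}.
Implicit Types (e : labels n k) (A : adjmat n).

Lemma sum_symmetric_half (f : 'I_k -> 'I_k -> R) : (forall a b, f a b = f b a) ->
  \sum_(a < k) \sum_(b < k | (a <= b)%N) (if a == b then f a b / 2 else f a b) =
  (\sum_(a < k) \sum_(b < k) f a b) / 2.
Proof.
move=> fC; pose g a b := if a == b then f a b / 2 else f a b.
have low : \sum_(a < k) \sum_(b < k | ~~ (a <= b)%N) f a b =
    \sum_(a < k) \sum_(b < k | (a < b)%N) f a b.
  under eq_bigr do rewrite big_mkcond/=.
  rewrite exchange_big/=; apply: eq_bigr => a _.
  rewrite [RHS]big_mkcond/=; apply: eq_bigr => b _.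
  by rewrite -ltnNge fC.
have up : \sum_(a < k) \sum_(b < k | (a <= b)%N) f a b =
    \sum_(a < k) f a a + \sum_(a < k) \sum_(b < k | (a < b)%N) f a b.
  rewrite -big_split/=; apply: eq_bigr => a _.
  rewrite (bigD1 a)//=; congr +%R; apply: eq_bigl => b.
  by rewrite ltn_neqAle andbC eq_sym.
have gE : \sum_(a < k) \sum_(b < k | (a <= b)%N) g a b =
    \sum_(a < k) f a a / 2 + \sum_(a < k) \sum_(b < k | (a < b)%N) f a b.
  rewrite -big_split/=; apply: eq_bigr => a _.
  rewrite (bigD1 a)//= {1}/g eqxx; congr +%R; apply: eq_big => b.
    by rewrite ltn_neqAle andbC eq_sym.
  by move=> /andP[_ /negbTE]; rewrite /g eq_sym => ->.
have -> : \sum_(a < k) \sum_(b < k) f a b =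
    \sum_(a < k) \sum_(b < k | (a <= b)%N) f a b +
    \sum_(a < k) \sum_(b < k | ~~ (a <= b)%N) f a b.
  rewrite -big_split/=; apply: eq_bigr => a _.
  exact: (bigID (fun b : 'I_k => (a <= b)%N)).
by rewrite gE low up -mulr_suml; lra.
Qed.

Lemma npairsC e a b : npairs e a b = npairs e b a.
Proof. by rewrite /npairs eq_sym; case: eqP => [->|_] //; rewrite mulrC. Qed.

Lemma oedgesC e A a b : (forall i j, A i j = A j i) -> oedges e A a b = oedges e A b a.
Proof.
move=> AC; rewrite /oedges exchange_big/=; apply: eq_bigr => i _.
by apply: eq_bigr => j _; rewrite AC [X in X && _]andbC.
Qed.

Lemma Q_ML_tau_sum e A : (0 < n)%N -> n%:R ^+ 2 * Q_ML e A = tau_sum e A / 2 :> R.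
Proof.
move=> n0; rewrite /Q_ML -/(tau_sum e A); field.
by rewrite pnatr_eq0 -lt0n n0.
Qed.

(** Each block errs by at most [ln (N + 1) + 1 + C], and [N + 1 <= (n + 1)^2] gives
    [ln (N + 1) <= 2 n]. The halved diagonal counts match a sum over [a <= b] with half of the sum
    over all blocks. *)
Lemma Q_ICL_tau_sum e A : (0 < n)%N ->
  (forall i, ~~ A i i) -> (forall i j, A i j = A j i) ->
  (forall a b, (0 < npairs e a b)%N) ->
  `|n%:R ^+ 2 * Q_ICL e A - tau_sum e A / 2| <=
    k%:R ^+ 2 * (2 + `|ln (betaR (2^-1) (2^-1))|) * (n%:R + 1) :> R.
Proof.
move=> n0 A0 AC Npos.
set C := `|ln _|.
have C0 : 0 <= C by exact: normr_ge0.
pose f a b : R := (npairs e a b)%:R * tau ((oedges e A a b)%:R / (npairs e a b)%:R).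
have nR : 1 <= n%:R :> R by rewrite ler1n.
have -> : n%:R ^+ 2 * Q_ICL e A = \sum_(a < k) \sum_(b < k | (a <= b)%N)
     ln (betaR (otilde e A a b + 2^-1) (ntilde e a b - otilde e A a b + 2^-1)
         / betaR (2^-1) (2^-1)) :> R.
  by rewrite /Q_ICL mulrA mulfV ?mul1r// expf_neq0// pnatr_eq0 -lt0n.
have -> : tau_sum e A / 2 = \sum_(a < k) \sum_(b < k | (a <= b)%N)
    (if a == b then f a b / 2 else f a b).
  rewrite sum_symmetric_half// => a b.
  by rewrite /f npairsC (oedgesC e A a b AC).
set c := (2 + C) * (n%:R + 1).
have -> : k%:R ^+ 2 * (2 + C) * (n%:R + 1) = \sum_(a < k) \sum_(b < k) c.
  by rewrite !sumr_const !card_ord -mulrnA -[RHS]mulr_natl natrM -expr2 mulrA.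
have c0 : 0 <= c by rewrite mulr_ge0//; lra.
rewrite -sumrB; apply: (le_trans (ler_norm_sum _ _ _)); apply: ler_sum => a _.
rewrite -sumrB; apply: (le_trans (ler_norm_sum _ _ _)).
rewrite big_mkcond; apply: ler_sum => b _; case: ifP => // _.
have oN : (oedges e A a b)%:R <= (npairs e a b)%:R :> R by exact: oedges_le_npairs.
have N0 : 0 < (npairs e a b)%:R :> R by rewrite ltr0n.
have o0 : 0 <= (oedges e A a b)%:R :> R by rewrite ler0n.
have Nn : (npairs e a b)%:R <= n%:R ^+ 2 :> R by exact: npairs_le_sqr.
have main (x N : R) : 0 <= x -> x <= N -> 0 < N -> N <= n%:R ^+ 2 ->
   `|ln (betaR (x + 2^-1) (N - x + 2^-1) / betaR (2^-1) (2^-1)) - N * tau (x / N)| <= c.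
  move=> x0 xN N_gt0 Nn2; have [h1 h2] := ln_beta_bounds x N x0 xN N_gt0.
  have lnN : ln (N + 1) <= 2 * n%:R.
    have n1 : 0 < n%:R + 1 :> R by lra.
    apply: (@le_trans _ _ (ln ((n%:R + 1) * (n%:R + 1)))).
      by rewrite ler_ln ?posrE; [nra|lra|exact: mulr_gt0].
    rewrite lnM ?posrE//; have := ln_le_subr1 _ n1; lra.
  have := ler_norm (ln (betaR (2^-1) (2^-1) : R)); rewrite -/C => h3.
  by rewrite ler_norml /c; apply/andP; split; nra.
rewrite /f /otilde /ntilde; case: eqP => _; last exact: main.
(* Halving both counts leaves the argument of [tau] unchanged. *)
have := main ((oedges e A a b)%:R / 2) ((npairs e a b)%:R / 2).
have -> : (oedges e A a b)%:R / 2 / ((npairs e a b)%:R / 2) =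
    (oedges e A a b)%:R / (npairs e a b)%:R :> R.
  by field; rewrite gt_eqF.
rewrite [(npairs e a b)%:R / 2 * _]mulrAC; apply; lra.
Qed.

End IclVersusMl.

(** * Bounds at a fixed graph size *)

Section FixedSize.
Context {R : realType} {n k : nat}.
Implicit Types (e z : labels n k) (A : adjmat n) (S : 'M[R]_k).

(** With [T = t n^2 rho] and [N0 = (al n)^2 / 2], division by [rho n^2] leaves errors in [t],
    [t / al] and [rho] only. Two class fractions appear: [al] may shrink with [n], while [q] stays
    fixed for the identification step. *)
Lemma mismatch_le_of_concentration S e z A (rho al q t s0 s1 Delta E eta : R) :
  (forall i, ~~ A i i) -> 0 < s0 -> (forall a b, s0 <= S a b <= s1) -> 0 < s1 ->
  0 < rho -> 0 < al -> 0 < q -> 4 <= q * n%:R -> 2 <= al * n%:R -> 0 < Delta ->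
  (forall c c', c != c' -> exists d, Delta <= (S c d - S c' d) ^+ 2) ->
  (forall c, al * n%:R <= (ncount e c)%:R) ->
  (forall c, al * n%:R <= (ncount z c)%:R) ->
  (forall c, q * n%:R <= (ncount z c)%:R) ->
  (forall e' a b, `|(oedges e' A a b)%:R - rho * mean_block S z e' a b|
      <= t * (n%:R ^+ 2 * rho)) ->
  tau_sum z A <= tau_sum e A + E ->
  4 * s1 * (k%:R ^+ 2 * (2 * (t * (`|ln s0| + `|ln s1|)) + 2 * (t / al) ^+ 2 / s0 +
      2 * rho * s1 ^+ 2 + 4 * rho * (t / al) ^+ 2) + E / (n%:R ^+ 2 * rho)) <= eta ->
  0 <= eta -> 8 * eta / (Delta * q) < q ->
  (mismatch e z)%:R <= 8 * eta / (Delta * q) * n%:R.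
Proof.
move=> A0 s00 HS s10 rho0 al0 q0 qn aln D0 sep He Hz Hzq conc HE Heta eta0 etaq.
have n0 : 0 < n%:R :> R by rewrite -(pmulr_rgt0 _ q0); lra.
apply: (mismatch_le_gap S z e (block_mean S z e)) => //; rewrite -/(gap_sum S z e).
set N0 := (al * n%:R) ^+ 2 / 2.
have N00 : 0 < N0 by rewrite divr_gt0// exprn_gt0//; lra.
have G := gap_sum_le S z e A rho (t * (n%:R ^+ 2 * rho)) s0 s1 N0 E A0 s00 HS rho0 N00
  (npairs_ge e al He aln) (npairs_ge z al Hz aln) conc HE.
apply: (@le_trans _ _ (4 * s1 * (k%:R ^+ 2 *
   (2 * (t * (`|ln s0| + `|ln s1|)) + 2 * (t / al) ^+ 2 / s0 +
      2 * rho * s1 ^+ 2 + 4 * rho * (t / al) ^+ 2) + E / (n%:R ^+ 2 * rho)) * n%:R ^+ 2)).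
  have c0 : 0 < rho / (4 * s1) by rewrite divr_gt0// mulr_gt0.
  rewrite -(ler_pM2l c0).
  have -> : rho / (4 * s1) * gap_sum S z e = rho * (gap_sum S z e / (4 * s1)) by ring.
  apply: (le_trans G); rewrite le_eqVlt; apply/orP; left; apply/eqP.
  rewrite /N0; field; rewrite !gt_eqF//.
by rewrite ler_wpM2r// sqr_ge0.
Qed.

Lemma finite_pos_lower (I : finType) (P : pred I) (f : I -> R) :
  (forall i, P i -> 0 < f i) -> exists2 m, 0 < m & forall i, P i -> m <= f i.
Proof.
(* The leading 1 keeps the witness [s^-1] positive when no index satisfies [P]. *)
move=> fpos; pose s := 1 + \sum_(i | P i) (f i)^-1.
have pos i : P i -> 0 <= (f i)^-1 by move=> Pi; rewrite invr_ge0 ltW// fpos.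
have s0 : 0 < s by rewrite ltr_pwDl// sumr_ge0.
exists s^-1; first by rewrite invr_gt0.
move=> i Pi; rewrite -[leRHS]invrK lef_pV2 ?posrE ?invr_gt0 ?fpos//.
rewrite /s (bigD1 i)//= addrCA lerDl addr_ge0// sumr_ge0// => j /andP[Pj _].
exact: pos.
Qed.

(* The normalisation of [t] makes the Chernoff exponent equal to [- n k], which
   beats the [k ^ n] labellings of the union bound. *)
Lemma sbm_prob_ge_exp (pi : 'I_k -> R) S (rho al t s1 : R)
    (E : labels n k -> adjmat n -> bool) :
  (forall a, 0 < pi a) -> \sum_(a < k) pi a = 1 -> (forall a b, S a b = S b a) ->
  0 < rho -> (forall a b, 0 <= rho * S a b <= 1) ->
  (forall c, al < pi c) -> (forall a b, S a b <= s1) -> 0 < s1 -> (0 < n)%N ->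
  0 <= t -> t <= 4 * s1 -> t ^+ 2 * (n%:R * rho) = 32 * s1 * k%:R ->
  (forall z A, (forall i, ~~ A i i) -> (forall i j, A i j = A j i) ->
    (forall c, al * n%:R <= (ncount z c)%:R) ->
    (forall e a b, `|(oedges e A a b)%:R - rho * mean_block S z e a b|
       <= t * (n%:R ^+ 2 * rho)) ->
    E z A) ->
  1 - (\sum_(c < k) ((pi c - al) ^+ 2 / 8)^-1 + 2 * k%:R ^+ 2) / n%:R
  <= sbm_prob pi S rho E.
Proof.
move=> pi0 pi1 SC rho0 P01 alpi Ss1 s10 n0 t0 ts t2 HE.
have nR : 0 < n%:R :> R by rewrite ltr0n.
(* Minimiser of [8 lam^2 s1 - lam t]; the bound [t <= 4 s1] is what gives [lam <= 1 / 4]. *)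
pose lam := t / (16 * s1).
have lam0 : 0 <= lam by rewrite divr_ge0// mulr_ge0// ltW.
have lam4 : lam <= 1 / 4.
  by rewrite /lam ler_pdivrMr ?mulr_gt0//; lra.
have := sbm_prob_ge pi S rho pi0 pi1 SC rho0 P01 E al _ lam s1 alpi Ss1 (ltW s10) lam0 lam4 HE.
apply: le_trans; rewrite lerD2l lerN2 [leRHS]mulrDl; apply: lerD.
  rewrite mulr_suml; apply: ler_sum => c _.
  have d0 : 0 < (pi c - al) ^+ 2 / 8 by rewrite divr_gt0// exprn_gt0// subr_gt0.
  by rewrite -invfM; apply: (le_trans (expRN_le _ (mulr_gt0 nR d0))); rewrite mulrC.
have -> : 8 * lam ^+ 2 * rho * s1 * n%:R ^+ 2 - lam * (t * (n%:R ^+ 2 * rho)) =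
   - (n%:R * k%:R).
  have -> : n%:R * k%:R = (t ^+ 2 * (n%:R * rho)) * n%:R / (32 * s1) :> R.
    by rewrite t2; field; rewrite gt_eqF.
  by rewrite /lam; field; rewrite gt_eqF.
(* [k <= exp (k - 1)], so a factor [exp (- n) <= 1 / n] survives the union bound. *)
have kn : (k ^ n)%:R <= expR (n%:R * (k%:R - 1)) :> R.
  rewrite natrX expRM_natl lerXn2r ?nnegrE ?expR_ge0//.
  have := expR_ge1Dx (k%:R - 1 : R); lra.
have -> : (k ^ n)%:R * (k%:R ^+ 2 * (2 * expR (- (n%:R * k%:R)))) =
   2 * k%:R ^+ 2 * ((k ^ n)%:R * expR (- (n%:R * k%:R))) :> R by ring.
apply: ler_wpM2l; first by rewrite mulr_ge0// sqr_ge0.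
apply: (le_trans (ler_wpM2r (expR_ge0 _) kn)).
rewrite -expRD; apply: le_trans (expRN_le _ nR).
rewrite ler_expR; lra.
Qed.

End FixedSize.

(** * Consistency *)

Section Consistency.
Context {R : realType}.

Lemma criterion_error_le (c n r x : R) : 0 <= c -> 1 <= n -> 0 < r ->
  (n * r)^-1 <= x ^+ 2 -> 4 * c * (n + 1) / (n ^+ 2 * r) <= 8 * c * x ^+ 2.
Proof.
move=> c0 n1 r0 hx.
have npos : 0 < n by lra.
have -> : 4 * c * (n + 1) / (n ^+ 2 * r) = 4 * c * ((n + 1) / n * (n * r)^-1).
  by field; rewrite !gt_eqF.
have h1 : (n + 1) / n <= 2 by rewrite ler_pdivrMr//; lra.
have h2 : (n + 1) / n * (n * r)^-1 <= 2 * x ^+ 2.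
  by apply: ler_pM => //; rewrite ?invr_ge0 ?divr_ge0 ?mulr_ge0// ?(ltW npos) ?(ltW r0)//; lra.
have := ler_wpM2l c0 h2; lra.
Qed.

Lemma near_maximizer_tau_sum (x1 x2 y1 y2 d m : R) :
  `|x1 - y1 / 2| <= d * m -> `|x2 - y2 / 2| <= d * m -> x1 <= x2 ->
  y1 <= y2 + 4 * d * m.
Proof. rewrite !ler_norml => /andP[h1 h2] /andP[h3 h4] h5; lra. Qed.

(** Common to both criteria: a criterion within [c (n + 1)] of [tau_sum / 2] after scaling by [n^2]
    loses only a relative error of order [1 / (n rho)]. *)
Lemma near_maximizers_weakly_consistent (k : nat) (pi : 'I_k -> R) (S : 'M[R]_k)
    (rho al : nat -> R) (Q : forall n, labels n k -> adjmat n -> R) (c : R) :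
  (2 <= k)%N -> (forall a, 0 < pi a) -> \sum_(a < k) pi a = 1 ->
  S^T = S -> (forall a b, 0 < S a b) ->
  (forall a b : 'I_k, a != b -> col a S != col b S) ->
  (forall n, 0 < rho n) -> (forall n a b, rho n * S a b <= 1) ->
  rho @ \oo --> 0 ->
  (forall n, 0 < al n) -> (forall n a, al n < pi a) ->
  (forall m n, (m <= n)%N -> al n <= al m) ->
  (fun n => al n * Num.sqrt (n%:R * rho n)) @ \oo --> +oo ->
  0 <= c ->
  (forall n (e : labels n k) (A : adjmat n), (0 < n)%N -> (forall i, ~~ A i i) -> (forall i j, A i j = A j i) ->
     (forall a b, (0 < npairs e a b)%N) ->
     `|n%:R ^+ 2 * Q n e A - tau_sum e A / 2| <= c * (n%:R + 1)) ->
  maximizers_weakly_consistent pi S rho al Q.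
Proof.
move=> k2 pi0 pi1 ST S0 Ssep rho0 rhoS rho_cvg al0 alpi almono al_cvg c0 HQ est Hest eps eps0.
have k0 : (0 < k)%N by apply: leq_trans k2.
have SC a b : S a b = S b a by rewrite -[in RHS]ST mxE.
have [s0 s00 s0S] := @finite_pos_lower R ('I_k * 'I_k)%type xpredT
  (fun p => S p.1 p.2) (fun p _ => S0 p.1 p.2).
pose s1 := \sum_(p : 'I_k * 'I_k) S p.1 p.2.
have Ss1 a b : S a b <= s1.
  rewrite /s1 (bigD1 (a, b))//= lerDl sumr_ge0// => p _; exact: ltW.
have s10 : 0 < s1.
  by apply: lt_le_trans (Ss1 (Ordinal k0) (Ordinal k0)); exact: S0.
have HS a b : s0 <= S a b <= s1 by rewrite Ss1 (s0S (a, b)).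
pose dist2 (p : 'I_k * 'I_k * 'I_k) := (S p.1.1 p.2 - S p.1.2 p.2) ^+ 2.
have [Delta D0 HD] := @finite_pos_lower R ('I_k * 'I_k * 'I_k)%type
  (fun p => 0 < dist2 p) dist2 (fun p h => h).
have sep a b : a != b -> exists d, Delta <= (S a d - S b d) ^+ 2.
  move=> /Ssep colab; have [d hd] : exists d, S d a != S d b.
    apply: contrapT => /forallNP h; move/eqP: colab; apply.
    apply/matrixP => i j; rewrite !mxE.
    by have /negP := h i; rewrite negbK => /eqP.
  exists d; apply: (HD (a, b, d)); rewrite /dist2/=.
  by rewrite lt_neqAle sqr_ge0 andbT eq_sym sqrf_eq0 subr_eq0 SC (SC b).
(* The largest value of [al], still below every [pi a]: with high probability all true classes
   exceed the fixed fraction [q]. *)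
pose q := al 0%N; have q0 : 0 < q := al0 0%N.
pose L := `|ln s0| + `|ln s1|.
have L0 : 0 <= L by rewrite addr_ge0.
pose C0 := Num.sqrt (32 * s1 * k%:R).
have C00 : 0 <= C0 by exact: sqrtr_ge0.
pose w n := al n * Num.sqrt (n%:R * rho n).
pose v n := (w n)^-1.
have v_cvg : v @ \oo --> 0.
  apply/gtr0_cvgV0; last exact: al_cvg.
  exact: cvgry_gt.
pose A1 := 4 * s1 * k%:R ^+ 2 * 2 * C0 * q * L.
pose A2 := 4 * s1 * (k%:R ^+ 2 * 2 * C0 ^+ 2 / s0 + 8 * c * q ^+ 2).
pose A3 := 4 * s1 * k%:R ^+ 2 * 2 * s1 ^+ 2.
pose A4 := 4 * s1 * k%:R ^+ 2 * 4 * C0 ^+ 2.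
pose eta n := A1 * v n + A2 * (v n * v n) + A3 * rho n + A4 * (rho n * (v n * v n)).
have eta_cvg : eta @ \oo --> 0.
  have -> : 0 = A1 * 0 + A2 * (0 * 0) + A3 * 0 + A4 * (0 * (0 * 0)) :> R by ring.
  have v2 : (fun n => v n * v n) @ \oo --> (0 * 0 : R) by exact: cvgM.
  apply: cvgD; [apply: cvgD; [apply: cvgD|]|]; apply: cvgM; try exact: cvg_cst.
  - exact: v_cvg.
  - exact: v2.
  - exact: rho_cvg.
  - exact: cvgM.
pose K := \sum_(b < k) ((pi b - q) ^+ 2 / 8)^-1 + 2 * k%:R ^+ 2.
have K0 : 0 <= K.
  rewrite addr_ge0 ?mulr_ge0 ?sqr_ge0// sumr_ge0// => b _.
  by rewrite invr_ge0 divr_ge0 ?sqr_ge0.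
(* [eta < thr] amounts to [8 eta / (Delta q) < min (q, eps)]: the bound [q] serves identification,
   [eps] the conclusion. *)
pose thr := Num.min q eps * (Delta * q) / 8.
have thr0 : 0 < thr by rewrite divr_gt0// mulr_gt0 ?lt_min ?q0// mulr_gt0.
(* [v < tv] forces [t <= 4 s1]; the added 1 makes the denominator positive. *)
pose tv := 4 * s1 / (C0 * q + 1).
have Cq0 : 0 < C0 * q + 1 by rewrite ltr_wpDl// mulr_ge0// ltW.
have tv0 : 0 < tv by rewrite divr_gt0// mulr_gt0.
apply: (@squeeze_cvgr _ _ _ _ (fun n => 1 - 2 * K * harmonic n) (cst 1)); last first.
- exact: cvg_cst.
- have h : (fun n => 1 - 2 * K * harmonic n) @ \oo --> (1 - 2 * K * 0 : R).
    apply: cvgB; first exact: cvg_cst.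
    by apply: cvgM; [exact: cvg_cst|exact: cvg_harmonic].
  by rewrite mulr0 subr0 in h.
near=> n.
have P01 a b : 0 <= rho n * S a b <= 1 by rewrite rhoS andbT mulr_ge0// ltW.
apply/andP; split; last exact: sbm_prob_le1.
have n0 : (0 < n)%N by near: n; exact: nbhs_infty_gt.
have nR : 1 <= n%:R :> R by rewrite ler1n.
have npos : 0 < n%:R :> R by rewrite ltr0n.
have qn4 : 4 <= q * n%:R.
  rewrite -ler_pdivrMl// mulrC; near: n; exact: nbhs_infty_ger.
have w2 : 2 <= w n by near: n; exact: cvgry_ge.
have rho1 : rho n <= 1.
  by apply: ltW; near: n; apply: (cvgr_lt 0) => //; exact: ltr01.
have etan : eta n < thr by near: n; exact: (cvgr_lt 0).
have vtv : v n < tv by near: n; exact: (cvgr_lt 0).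
set r := rho n in P01 rho1 *.
have r0 : 0 < r := rho0 n.
set a := al n; have a0 : 0 < a := al0 n.
have aq : a <= q by exact: almono.
set s := Num.sqrt (n%:R * r).
have nr0 : 0 < n%:R * r by rewrite mulr_gt0.
have s_gt0 : 0 < s by rewrite sqrtr_gt0.
have s2 : s ^+ 2 = n%:R * r by rewrite sqr_sqrtr// ltW.
have wE : w n = a * s by [].
have vE : v n = (a * s)^-1 by [].
have v0 : 0 < v n by rewrite vE invr_gt0 mulr_gt0.
pose t := C0 / s.
have t0 : 0 <= t by rewrite divr_ge0// ltW.
have sv : s^-1 <= q * v n.
  rewrite vE invfM mulrA ler_peMl ?invr_ge0 ?(ltW s_gt0)//.
  by rewrite ler_pdivlMr// mul1r.
have tCq : t <= C0 * (q * v n) by rewrite /t ler_wpM2l.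
have taE : t / a = C0 * v n by rewrite /t vE invfM; ring.
have t4 : t <= 4 * s1.
  apply: (le_trans tCq); rewrite mulrA.
  apply: (@le_trans _ _ ((C0 * q + 1) * v n)); first by rewrite ler_pM2r// lerDl.
  by rewrite mulrC -ler_pdivlMr// ltW.
have t2 : t ^+ 2 * (n%:R * r) = 32 * s1 * k%:R.
  rewrite -s2 /t expr_div_n divfK ?expf_neq0 ?gt_eqF// sqr_sqrtr//.
  by rewrite !mulr_ge0// ltW.
(* [sqrt (n rho) <= n] because [rho <= 1 <= n], hence [al n >= w n >= 2]. *)
have an2 : 2 <= a * n%:R.
  apply: (le_trans w2); rewrite wE ler_pM2l//.
  rewrite -ler_sqr ?nnegrE ?ler0n ?(ltW s_gt0)// s2 expr2.
  by apply: ler_wpM2l; [exact: ler0n|exact: le_trans nR].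
apply: (@le_trans _ _ (1 - K / n%:R)).
  (* [harmonic n] is [1 / (n + 1)], and [1 / n <= 2 / (n + 1)]. *)
  have -> : 2 * K * harmonic n = K * (2 / n.+1%:R) by rewrite /harmonic/=; ring.
  rewrite lerD2l lerN2 ler_wpM2l// ler_pdivlMr ?ltr0n//.
  by rewrite mulrC ler_pdivrMr// -natr1 mulr2n mulrDl mul1r lerD2l.
apply: (@sbm_prob_ge_exp R n k pi S r q t s1) => //; first exact: (alpi 0%N).
move=> z A A0 AC Hz conc.
have Hza b : a * n%:R <= (ncount z b)%:R.
  by apply: le_trans (Hz b); rewrite ler_wpM2r// ler0n.
(* The true labelling is itself a candidate, so the estimator scores at least as well. *)
have zF : z \in Fset n k a by rewrite inE; apply/forallP => b; exact: Hza.
have [eF Qle] := Hest n A z zF.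
set e := est n A in eF Qle *.
have He b : a * n%:R <= (ncount e b)%:R by move: eF; rewrite inE => /forallP.
have Npos (e' : labels n k) : (forall b, a * n%:R <= (ncount e' b)%:R) ->
    forall b b', (0 < npairs e' b b')%N.
  move=> h b b'; rewrite -(ltr0n R).
  apply: lt_le_trans (npairs_ge e' a h an2 b b').
  by rewrite divr_gt0// exprn_gt0// mulr_gt0.
have Q1 := HQ n z A n0 A0 AC (Npos z Hza).
have Q2 := HQ n e A n0 A0 AC (Npos e He).
have HE : tau_sum z A <= tau_sum e A + 4 * c * (n%:R + 1).
  have : n%:R ^+ 2 * Q n z A <= n%:R ^+ 2 * Q n e A by rewrite ler_wpM2l// sqr_ge0.
  exact: near_maximizer_tau_sum Q1 Q2.
have etaE : eta n = 4 * s1 * (k%:R ^+ 2 * (2 * (C0 * (q * v n) * L) +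
    2 * (C0 * v n) ^+ 2 / s0 + 2 * r * s1 ^+ 2 + 4 * r * (C0 * v n) ^+ 2)
    + 8 * c * (q * v n) ^+ 2).
  by rewrite /eta /A1 /A2 /A3 /A4 -/r; field; rewrite gt_eqF.
have eta0 : 0 <= eta n.
  rewrite etaE; repeat first [apply: addr_ge0 | apply: mulr_ge0 | exact: sqr_ge0
    | exact: ler0n | by [] | exact: ltW | by rewrite invr_ge0 ltW].
have etaq : 8 * eta n / (Delta * q) < Num.min q eps.
  rewrite ltr_pdivrMr ?mulr_gt0//; move: etan; rewrite /thr ltr_pdivlMr// mulrC //.
move: (etaq); rewrite lt_min => /andP[etaq' etaeps].
have M := @mismatch_le_of_concentration R n k S e z A r a q t s0 s1 Delta
  (4 * c * (n%:R + 1)) (eta n) A0 s00 HS s10 r0 a0 q0 qn4 an2 D0 sep He Hza Hz conc HE _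
  eta0 etaq'.
apply: (le_lt_trans (M _)); last by rewrite ltr_pM2r.
rewrite taE etaE.
have tail : 4 * c * (n%:R + 1) / (n%:R ^+ 2 * r) <= 8 * c * (q * v n) ^+ 2.
  apply: criterion_error_le => //; rewrite -s2 -exprVn.
  by rewrite lerXn2r ?nnegrE ?invr_ge0 ?mulr_ge0// ?(ltW s_gt0) ?(ltW q0) ?(ltW v0).
rewrite ler_pM2l ?mulr_gt0//; apply: lerD => //.
apply: ler_wpM2l; first exact: sqr_ge0.
do 3 apply: lerD => //.
by apply: ler_wpM2l => //; apply: ler_wpM2r.
Unshelve. all: by end_near. Qed.

End Consistency.

Theorem theorem1 (R : realType) (k : nat) (pi : 'I_k -> R) (S : 'M[R]_k)
    (rho : nat -> R) :
  (2 <= k)%N ->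
  (forall a, 0 < pi a) -> \sum_(a < k) pi a = 1 ->
  S^T = S -> (forall a b, 0 < S a b) ->
  (forall a b : 'I_k, a != b -> col a S != col b S) ->
  (forall n, 0 < rho n) -> (forall n a b, rho n * S a b <= 1) ->
  rho @ \oo --> 0 ->
  (fun n => n%:R * rho n) @ \oo --> +oo ->
  (* constant alpha < min_a pi_a *)
  (forall alpha : R, 0 < alpha -> (forall a, alpha < pi a) ->
     maximizers_weakly_consistent pi S rho (fun _ => alpha) (fun n => @Q_ML R n k)
  /\ maximizers_weakly_consistent pi S rho (fun _ => alpha) (fun n => @Q_ICL R n k))
  /\
  (* alpha_n decreasing with n, alpha_n >> (n rho_n)^(-1/2) *)
  (forall alpha : nat -> R,
     (forall n, 0 < alpha n) -> (forall n a, alpha n < pi a) ->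
     (forall m n, (m <= n)%N -> alpha n <= alpha m) ->
     (fun n => alpha n * Num.sqrt (n%:R * rho n)) @ \oo --> +oo ->
     maximizers_weakly_consistent pi S rho alpha (fun n => @Q_ML R n k)
  /\ maximizers_weakly_consistent pi S rho alpha (fun n => @Q_ICL R n k)).
Proof.
move=> k2 pi0 pi1 ST S0 Ssep rho0 rhoS rho_cvg nrho_cvg.
have main (alpha : nat -> R) :
     (forall n, 0 < alpha n) -> (forall n a, alpha n < pi a) ->
     (forall m n, (m <= n)%N -> alpha n <= alpha m) ->
     (fun n => alpha n * Num.sqrt (n%:R * rho n)) @ \oo --> +oo ->
     maximizers_weakly_consistent pi S rho alpha (fun n => @Q_ML R n k)
  /\ maximizers_weakly_consistent pi S rho alpha (fun n => @Q_ICL R n k).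
  move=> al0 alpi almono al_cvg; split.
    apply: (@near_maximizers_weakly_consistent R k pi S rho alpha _ 0) => //.
    by move=> n e A n0 _ _ _; rewrite Q_ML_tau_sum// subrr normr0 mul0r.
  pose c : R := k%:R ^+ 2 * (2 + `|ln (betaR (2^-1) (2^-1))|).
  have c0 : 0 <= c by apply: mulr_ge0; [exact: sqr_ge0|exact: addr_ge0].
  apply: (@near_maximizers_weakly_consistent R k pi S rho alpha _ c) => //.
  by move=> n e A n0 A0 AC Npos; exact: Q_ICL_tau_sum.
split; last exact: main.
move=> alpha alpha0 alphapi; apply: main => //.
(* For constant [alpha] it suffices that [n rho >= (|B| / alpha)^2] eventually. *)
apply/cvgryPge => B; near=> n.
have B0 : 0 <= `|B| / alpha by rewrite divr_ge0// ltW.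
apply: le_trans (ler_norm B) _.
rewrite mulrC -ler_pdivrMr// -(ger0_norm B0) -sqrtr_sqr ler_wsqrtr//.
by near: n; exact: cvgry_ge.
Unshelve. all: by end_near. Qed.
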